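(* Let $H$ be a Hermitian operator on an $n$-qubit Hilbert space with orthonormal eigenstates $|\psi_k\rangle$ and eigenvalues $E_k$, let $\Lambda\in\mathbb{R}$ and $0<\delta,\epsilon,\gamma<1$. Suppose one has access to a $(\lambda,m,0)$-block-encoding $U_H$ of $H$ and to an initial state preparation oracle $U_I$ that satisfies $$U_I|0\rangle=\sum_k\alpha_k|\psi_k\rangle,\qquad\sum_{k:E_k\le\Lambda-\delta(\lambda+|\Lambda|)}|\alpha_k|^2>\gamma^2 .$$ Then a state with fidelity $1-\epsilon$ in $\mathcal{H}_{\Lambda+\delta(\lambda+|\Lambda|)}$ can be prepared, by the amplitude amplification circuit described in the context, using: 1. $O\left(\frac{1}{\gamma(1-\epsilon\gamma)\delta}\log\frac{1}{\gamma\epsilon}\right)$ queries to $U_H$ and $O\left(\frac{1}{\gamma(1-\epsilon\gamma)}\right)$ queries to $U_I$; 2. $O(m+n)$ total qubits, $O(m)$ auxiliary and $O(n)$ for the system register; 3. $O\left(\frac{m}{\gamma(1-\epsilon\gamma)\delta}\log\frac{1}{\gamma\epsilon}\right)$ other one- and two-qubit gates.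
   Context: A unitary $U$ is a $(\lambda,m,0)$-block-encoding of $A$ if $A=\lambda(\langle0^m|\otimes I)U(|0^m\rangle\otimes I)$. $\mathcal{H}_x=\mathrm{span}\{|\psi_k\rangle:E_k\le x\}$ and $P_x$ is the orthogonal projector onto it. Queries to a unitary include queries to its inverse (and controlled versions). ''A state with fidelity $1-\epsilon$ in $\mathcal{H}_x$'' means: the output $|\psi'\rangle$ of the circuit has unit overlap with the sector in which the $m+3$ ancilla qubits are $|0^{m+3}\rangle$, i.e. $\|(\langle0^{m+3}|\otimes I)|\psi'\rangle\|=1$, and $\|(1-P_x)(\langle0^{m+3}|\otimes I)|\psi'\rangle\|<\epsilon$. $S(\cdot;\delta,\epsilon)$ is an odd real polynomial of degree $l=O(\frac1\delta\log\frac1\epsilon)$ with $|S|\le1$ on $[-1,1]$ and $|S(x;\delta,\epsilon)-\mathrm{sign}(x)|\le\epsilon$ for $\delta\le|x|\le1$. $U_S(\Lambda,\delta,\epsilon)$ is a $(1,m+2,0)$-block-encoding of $-S((H-\Lambda I)/(\lambda+|\Lambda|);\delta,\epsilon)$, constructed by quantum signal processing with $l$ queries to $U_H$ and $O((m+2)l)$ other primitive gates. $U_\theta(\Lambda,\delta,\epsilon)$ acts on $1+(m+2)+n$ qubits: a Hadamard on the first qubit, then $U_S$ controlled on the first qubit, then a Hadamard on the first qubit. Circuit: apply $U_I$ to the system register $|0^n\rangle$, then $U_\theta(\Lambda,\delta,\epsilon\gamma)$ to the registers initialized in $|0^{m+3}\rangle$ and the system, then repeat the amplitude amplification iterate $Q=-\mathcal{A}S_0\mathcal{A}^{-1}S_\chi$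 (in the standard variant of Brassard et al. with one extra ancilla qubit, which reaches the final unit overlap exactly), where $\mathcal{A}=U_\theta(\Lambda,\delta,\epsilon\gamma)(I\otimes I\otimes U_I)$, $S_\chi=(2|0^{m+3}\rangle\langle0^{m+3}|-I)\otimes I$, and $S_0$ is the reflection about the all-zero state.
   Formalization: The gate bound in item 3 carries an extra O(n) gates for each of the O(1/(γ(1-εγ))) amplification iterates, because the reflection about the all-zero state touches all n system qubits; O(m) is read as O(max(1,m)), since the bounds fail for m=0. *)

(* Defs.v *)
From HB Require Import structures.
From mathcomp Require Import all_boot all_order all_algebra.
From mathcomp Require Export complex.
From mathcomp Require Export reals exp.

Set Implicit Arguments.
Unset Strict Implicit.
Unset Printing Implicit Defensive.

Import Order.TTheory GRing.Theory Num.Theory.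
Local Open Scope ring_scope.
Local Open Scope sesquilinear_scope.

(* The computational basis of n qubits is the set of bit strings
   {ffun 'I_n -> bool}; operators and kets are matrices whose indices are the
   ranks of these bit strings.  In a register 'I_(a + k), the
   first a wires are the tensor factor on the left. *)
Definition qdim (n : nat) : nat := #|{ffun 'I_n -> bool}|.

Lemma qdimE n : qdim n = (2 ^ n)%N.
Proof. by rewrite /qdim card_ffun card_bool card_ord. Qed.

Definition bits n (i : 'I_(qdim n)) : {ffun 'I_n -> bool} := enum_val i.
Definition rank n (x : {ffun 'I_n -> bool}) : 'I_(qdim n) := enum_rank x.

Section Registers.
Variable C : numClosedFieldType.

Definition ket0 n : 'cV[C]_(qdim n) := delta_mx (rank [ffun=> false]) 0.

(* |0^a> (x) I, as a map from k qubits to a + k qubits. *)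
Definition anc0 a k : 'M[C]_(qdim (a + k), qdim k) :=
  \matrix_(i, j) (bits i == [ffun q : 'I_(a + k) =>
     match split q with inl _ => false | inr r => bits j r end])%:R.

(* g acting on the wires f 0, ..., f (k - 1) of an N-qubit register and as the
   identity on all other wires; meaningful when f is injective. *)
Definition onwires k N (f : 'I_k -> 'I_N) (g : 'M[C]_(qdim k)) :
    'M[C]_(qdim N) :=
  \matrix_(i, j)
    if [forall q : 'I_N, (q \notin codom f) ==> (bits i q == bits j q)]
    then g (rank [ffun a => bits i (f a)]) (rank [ffun a => bits j (f a)])
    else 0.

(* |0><0| (x) I + |1><1| (x) U *)
Definition ctrlmx k (U : 'M[C]_(qdim k)) : 'M[C]_(qdim (1 + k)) :=
  \matrix_(i, j)
    let i' := rank [ffun a : 'I_k => bits i (rshift 1 a)] in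
    let j' := rank [ffun a : 'I_k => bits j (rshift 1 a)] in
    if bits i (lshift k ord0) == bits j (lshift k ord0)
    then (if bits i (lshift k ord0) then U i' j' else (i' == j')%:R) else 0.

Definition hadamard : 'M[C]_(qdim 1) :=
  \matrix_(i, j)
    ((-1) ^+ (bits i ord0 && bits j ord0) / sqrtC 2).

Definition block_encodes a k (lam : C)
    (U : 'M[C]_(qdim (a + k))) (A : 'M[C]_(qdim k)) : Prop :=
  U \is unitarymx /\ A = lam *: ((anc0 a k)^t* *m U *m anc0 a k).

End Registers.

Section Circuits.
Variables (C : numClosedFieldType) (m n : nat).

Inductive oracle := HamOracle | PrepOracle.

Definition oracle_eqb (o o' : oracle) : bool :=
  match o, o' with
  | HamOracle, HamOracle | PrepOracle, PrepOracle => true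
  | _, _ => false
  end.

Definition oarity (o : oracle) : nat :=
  match o with HamOracle => m + n | PrepOracle => n end.

(* The boolean of a (controlled) query tells whether the inverse of the oracle
   is used; the control of a CQuery is wire 0 of its wiring map. *)
Inductive instr (N : nat) : Type :=
| Gate k (g : 'M[C]_(qdim k)) (f : 'I_k -> 'I_N) of
    (0 < k <= 2)%N & g \is unitarymx & injective f
| Query (o : oracle) (inv : bool) (f : 'I_(oarity o) -> 'I_N) of injective f
| CQuery (o : oracle) (inv : bool) (f : 'I_(1 + oarity o) -> 'I_N) of
    injective f.

(* The head of the list is applied first. *)
Definition circuit (N : nat) := seq (instr N).

Definition is_gate N (i : instr N) : bool :=
  if i is Gate _ _ _ _ _ _ then true else false.

Definition is_query (o : oracle) N (i : instr N) : bool :=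
  match i with
  | Gate _ _ _ _ _ _ => false
  | Query o' _ _ _ | CQuery o' _ _ _ => oracle_eqb o o'
  end.

Definition gates N (c : circuit N) : nat := count (@is_gate N) c.
Definition queries (o : oracle) N (c : circuit N) : nat :=
  count (@is_query o N) c.

Variables (UH : 'M[C]_(qdim (m + n))) (UI : 'M[C]_(qdim n)).

Definition oracle_mx (o : oracle) (inv : bool) : 'M[C]_(qdim (oarity o)) :=
  let U := match o return 'M[C]_(qdim (oarity o)) with
           | HamOracle => UH | PrepOracle => UI end in
  if inv then invmx U else U.

Definition instr_mx N (i : instr N) : 'M[C]_(qdim N) :=
  match i with
  | Gate _ g f _ _ _ => onwires f g
  | Query o inv f _ => onwires f (oracle_mx o inv)
  | CQuery o inv f _ => onwires f (ctrlmx (oracle_mx o inv))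
  end.

Fixpoint circuit_mx N (c : circuit N) : 'M[C]_(qdim N) :=
  if c is i :: c' then circuit_mx c' *m instr_mx i else 1%:M.

(* c implements V with w work qubits, taken in |0^w> and returned in |0^w>. *)
Definition implements w N (c : circuit (w + N)) (V : 'M[C]_(qdim N)) : Prop :=
  circuit_mx c *m anc0 C w N = anc0 C w N *m V.

End Circuits.

Section AmplitudeAmplification.
Variables (C : numClosedFieldType) (m n : nat).

(* Hadamard - controlled U_S - Hadamard; 1 + (m.+2 + n) is convertible to
   m.+3 + n, so the control is the first of the m.+3 ancillas. *)
Definition Utheta (US : 'M[C]_(qdim (m.+2 + n))) : 'M[C]_(qdim (m.+3 + n)) :=
  let h := onwires (@lshift 1 (m.+2 + n)) (hadamard C) in
  h *m ctrlmx US *m h.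

Definition aa_prep (US : 'M[C]_(qdim (m.+2 + n))) (UI : 'M[C]_(qdim n)) :
    'M[C]_(qdim (m.+3 + n)) :=
  Utheta US *m onwires (@rshift m.+3 n) UI.

(* Exact variant of Brassard, Hoyer, Mosca and Tapp: A (x) I is preceded by a
   rotation B of an additional ancilla, which lowers the success amplitude to
   one that is amplified to exactly 1.  The additional ancilla is put in front
   of the others, and good means that all m.+4 ancillas are zero. *)
Definition exact_prep (B : 'M[C]_(qdim 1)) (A : 'M[C]_(qdim (m.+3 + n))) :
    'M[C]_(qdim (m.+4 + n)) :=
  onwires (@rshift 1 (m.+3 + n)) A *m onwires (@lshift 1 (m.+3 + n)) B.

Definition S_chi : 'M[C]_(qdim (m.+4 + n)) :=
  2 *: (anc0 C m.+4 n *m (anc0 C m.+4 n)^t*) - 1%:M.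

Definition S_zero : 'M[C]_(qdim (m.+4 + n)) :=
  2 *: (ket0 C (m.+4 + n) *m (ket0 C (m.+4 + n))^t*) - 1%:M.

Definition aa_iterate (A : 'M[C]_(qdim (m.+4 + n))) :
    'M[C]_(qdim (m.+4 + n)) :=
  - (A *m S_zero *m invmx A *m S_chi).

Definition amplify (B : 'M[C]_(qdim 1)) (US : 'M[C]_(qdim (m.+2 + n)))
    (UI : 'M[C]_(qdim n)) (r : nat) : 'M[C]_(qdim (m.+4 + n)) :=
  let A := exact_prep B (aa_prep US UI) in aa_iterate A ^+ r *m A.

End AmplitudeAmplification.

Section Spectral.
Variable R : realType.
Local Notation C := R[i].

Definition l2norm d (v : 'cV[C]_d) : R :=
  Num.sqrt (\sum_i Normc.normc (v i 0) ^+ 2).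

Definition orthonormal_eigenstates d (H : 'M[C]_d)
    (psi : 'I_d -> 'cV[C]_d) (E : 'I_d -> R) : Prop :=
  (forall j k, (psi j)^t* *m psi k = (j == k)%:R%:M) /\
  (forall k, H *m psi k = (E k)%:C%C *: psi k).

Definition low_energy d (psi : 'I_d -> 'cV[C]_d) (E : 'I_d -> R) (x : R) :
    {vspace 'cV[C]_d} :=
  <<[seq psi k | k <- enum 'I_d & (E k <= x)%R]>>%VS.

Definition orth_projector_onto d (P : 'M[C]_d) (V : {vspace 'cV[C]_d}) :
    Prop :=
  [/\ P^t* = P, P *m P = P & forall v : 'cV[C]_d, v \in V <-> P *m v = v].

Definition fidelity_state m n (eps : R) (P : 'M[C]_(qdim n))
    (psi' : 'cV[C]_(qdim (m.+3 + n))) : Prop :=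
  let phi := (anc0 C m.+3 n)^t* *m psi' in
  l2norm phi = 1 /\ l2norm ((1%:M - P) *m phi) < eps.

Definition degree (S : {poly R}) : nat := (size S).-1.

(* c is the constant of the degree bound.  It reads 1 + log(1/e) because an odd
   S with error e < 1 has degree >= 1, whereas log(1/e) -> 0 as e -> 1; for e
   bounded away from 1 this is the same as O(d^-1 log(1/e)). *)
Definition sign_poly (c d e : R) (S : {poly R}) : Prop :=
  [/\ S \Po (- 'X) = - S,
      (degree S)%:R <= c * (d^-1 * (1 + ln (e^-1))),
      (forall x : R, `|x| <= 1 -> `|S.[x]| <= 1) &
      (forall x : R, d <= `|x| <= 1 -> `|S.[x] - Num.sg x| <= e)].

Definition polymx d (S : {poly R}) (A : 'M[C]_d) : 'M[C]_d :=
  \sum_(i < size S) (S`_i)%:C%C *: A ^+ i.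

(* -S((H - Lam I) / (lam + |Lam|)) *)
Definition neg_sign_op d (S : {poly R}) (H : 'M[C]_d) (lam Lam : R) :
    'M[C]_d :=
  - polymx S (((lam + `|Lam|)^-1)%:C%C *: (H - (Lam%:C%C)%:M)).

(* The block-encoding obtained by quantum signal processing, known through its
   unitary US, its resource counts and the circuit cS, which uses no qubits
   besides the m + 2 + n ones of US. *)
Definition qsp_circuit m n (c : R) (UH : 'M[C]_(qdim (m + n)))
    (UI : 'M[C]_(qdim n)) (H : 'M[C]_(qdim n)) (lam Lam : R) (S : {poly R})
    (US : 'M[C]_(qdim (m.+2 + n))) (cS : circuit C m n (m.+2 + n)) : Prop :=
  [/\ block_encodes 1 US (neg_sign_op S H lam Lam),
      circuit_mx UH UI cS = US,
      (queries HamOracle cS <= degree S)%N,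
      queries PrepOracle cS = 0%N &
      (gates cS)%:R <= c * ((m + 2) * degree S)%:R].

End Spectral.

(* Main.v *)
(* The Hadamard test turns the block-encoding of -S into one of (1 - S) / 2,
   which multiplies alpha_k by a factor at least 1/2 below the gap and at most
   eps * gamma / 2 in absolute value above it.  The success amplitude p
   therefore exceeds gamma / 2, and the part of the normalised good component
   outside the target space is at most (eps * gamma / 2) / p < eps.  For
   r > 2 / gamma the angle theta = pi / (2 (2 r + 1)) has
   sin theta <= theta < p, so a rotation of the extra ancilla with amplitude
   sin theta / p lowers the success amplitude to sin theta, and r iterates
   then rotate the state by 2 r theta exactly onto the good subspace.

   For the gate count, a two-qubit unitary is controlled by diagonalising it; a
   controlled query is controlled again with one Toffoli gate on each side; and
   the reflections are implemented with a number of gates linear in the number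
   of qubits by using the data wires as borrowed work qubits.  As
   1 - x <= ln (1 / x), the degree bound 1 + ln (1 / (eps * gamma)) is at most
   2 ln (1 / (eps * gamma)) / (1 - eps * gamma). *)
Require Import Defs.
From HB Require Import structures.
From mathcomp Require Import all_boot all_order all_algebra.
From mathcomp Require Import ring lra zify.
From mathcomp Require Import topology normedtype derive trigo.

Set Implicit Arguments.
Unset Strict Implicit.
Unset Printing Implicit Defensive.

Import Order.TTheory GRing.Theory Num.Theory.
Local Open Scope ring_scope.
Local Open Scope sesquilinear_scope.

(** * Operators on wires and computational basis states *)

Section BitStrings.

(** Two remarks frame the estimates. [S] is controlled only on [-1, 1], so the spectrum of H has to
    be confined to [-lam, lam]; this is read off the block-encoding itself. And no bound is
    available for the factor of alpha_k when E_k falls inside the gap: such eigenstates belong to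
    the target space, so they do no harm there and can only enlarge p.

    On the circuit side, the circuit of U_S is an arbitrary list of instructions. It may already
    contain controlled queries, whereas no instruction is a doubly controlled query, so controlling
    U_S calls for a clean work qubit. Circuits with work qubits compose only if these return to
    zero, and they must be inverted as well, since the iterate contains the inverse of its
    preparation. Hence two levels: [computes], where a circuit equals an operator on all its wires,
    and [realizes], where it does so as long as two work qubits start in zero, a relation closed
    under products, powers and inverses.

    The rotation B depends on the exact value of p, which is why it is obtained existentially. *)

Lemma bitsK n : cancel (@bits n) (@rank n).
Proof. by move=> i; rewrite /bits /rank enum_valK. Qed.

Lemma rankK n : cancel (@rank n) (@bits n).
Proof. by move=> x; rewrite /bits /rank enum_rankK. Qed.

Lemma rank_inj n : injective (@rank n).
Proof. exact: can_inj (@rankK n). Qed.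

Lemma sum_bits (V : nmodType) n (F : 'I_(qdim n) -> V) :
  \sum_i F i = \sum_(x : {ffun 'I_n -> bool}) F (rank x).
Proof.
rewrite (reindex (@rank n)) //=.
by exists (@bits n) => ? _; [exact: rankK|exact: bitsK].
Qed.

Lemma mx_bitsP (C : Type) n p (A B : 'M[C]_(qdim n, p)) :
  (forall x j, A (rank x) j = B (rank x) j) -> A = B.
Proof. by move=> AB; apply/matrixP => i j; rewrite -(bitsK i) AB. Qed.

Lemma mx_bits2P (C : Type) n p (A B : 'M[C]_(qdim n, qdim p)) :
  (forall x y, A (rank x) (rank y) = B (rank x) (rank y)) -> A = B.
Proof. by move=> AB; apply/mx_bitsP => x j; rewrite -(bitsK j) AB. Qed.

Variables (k N : nat) (f : 'I_k -> 'I_N).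
Implicit Types (x y z : {ffun 'I_N -> bool}) (u : {ffun 'I_k -> bool}).

Definition restr (x : {ffun 'I_N -> bool}) : {ffun 'I_k -> bool} :=
  [ffun a => x (f a)].

Definition upd (x : {ffun 'I_N -> bool}) (u : {ffun 'I_k -> bool}) :
    {ffun 'I_N -> bool} :=
  [ffun q => if [pick a | f a == q] is Some a then u a else x q].

Definition agree_off (x y : {ffun 'I_N -> bool}) : bool :=
  [forall q : 'I_N, (q \notin codom f) ==> (x q == y q)].

Lemma agree_offP x y :
  reflect (forall q, q \notin codom f -> x q = y q) (agree_off x y).
Proof.
apply: (iffP forallP) => [xy q qf|xy q]; first exact/eqP/(implyP (xy q)).
by apply/implyP => qf; rewrite xy.
Qed.

Lemma upd_out x u q : q \notin codom f -> upd x u q = x q.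
Proof.
rewrite ffunE; case: pickP => // a /eqP <-.
by rewrite codom_f.
Qed.

Hypothesis f_inj : injective f.

Lemma upd_in x u a : upd x u (f a) = u a.
Proof.
rewrite ffunE; case: pickP => [b /eqP/f_inj -> //|/(_ a)].
by rewrite eqxx.
Qed.

Lemma restr_upd x u : restr (upd x u) = u.
Proof. by apply/ffunP => a; rewrite ffunE upd_in. Qed.

Lemma upd_restr x y : agree_off x y -> upd x (restr y) = y.
Proof.
move=> /agree_offP xy; apply/ffunP => q.
have [/codomP[a ->]|qf] := boolP (q \in codom f).
  by rewrite upd_in ffunE.
by rewrite upd_out // xy.
Qed.

Lemma agree_upd x u : agree_off x (upd x u).
Proof. by apply/agree_offP => q qf; rewrite upd_out. Qed.

Lemma agree_off_refl x : agree_off x x.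
Proof. exact/agree_offP. Qed.

Lemma agree_off_sym x y : agree_off x y = agree_off y x.
Proof. by apply/agree_offP/agree_offP => xy q /xy. Qed.

Lemma agree_off_trans x y z : agree_off x y -> agree_off x z = agree_off y z.
Proof.
move=> /agree_offP xy; apply/agree_offP/agree_offP => h q qf.
  by rewrite -xy // h.
by rewrite xy // h.
Qed.

Lemma agree_restr_eq x y : agree_off x y -> restr x = restr y -> x = y.
Proof.
by move=> xy e; rewrite -(upd_restr xy) -e upd_restr // agree_off_refl.
Qed.

(** Row x of an operator on the wires [f] vanishes outside the columns agreeing with x off these
    wires. Indexing those columns by their string on [f] turns a product with such an operator into
    a sum over k bits. *)
Lemma sum_agree_off (V : nmodType) x (F : {ffun 'I_N -> bool} -> V) :
  \sum_(y | agree_off x y) F y = \sum_u F (upd x u).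
Proof.
rewrite (reindex (upd x)) /=; first by apply: eq_bigl => u; rewrite agree_upd.
exists restr => [u _|y /upd_restr //]; exact: restr_upd.
Qed.

End BitStrings.

Section Embeddings.
Variable C : numClosedFieldType.

Lemma onwiresE k N (f : 'I_k -> 'I_N) (g : 'M[C]_(qdim k)) x y :
  onwires f g (rank x) (rank y) =
  if agree_off f x y then g (rank (restr f x)) (rank (restr f y)) else 0.
Proof. by rewrite mxE !rankK. Qed.

Lemma onwires_mulE k N (f : 'I_k -> 'I_N) (g : 'M[C]_(qdim k)) p
    (A : 'M[C]_(qdim N, p)) x j : injective f ->
  (onwires f g *m A) (rank x) j =
  \sum_u g (rank (restr f x)) (rank u) * A (rank (upd f x u)) j.
Proof.
move=> f_inj; rewrite mxE sum_bits.
under eq_bigr => y _ do rewrite onwiresE.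
rewrite (bigID (agree_off f x)) /= [X in _ + X]big1 ?addr0; last first.
  by move=> y /negPf ->; rewrite mul0r.

rewrite sum_agree_off //; apply: eq_bigr => u _.
by rewrite agree_upd restr_upd.
Qed.

Lemma onwiresM k N (f : 'I_k -> 'I_N) (g h : 'M[C]_(qdim k)) : injective f ->
  onwires f (g *m h) = onwires f g *m onwires f h.
Proof.
move=> f_inj; apply: mx_bits2P => x y; rewrite onwires_mulE // onwiresE.
under eq_bigr => u _ do
  rewrite onwiresE restr_upd // -(agree_off_trans _ (agree_upd f x u)).
case: ifP => xy; last by rewrite big1 // => u _; rewrite mulr0.
by rewrite mxE sum_bits.
Qed.

Lemma onwires1 k N (f : 'I_k -> 'I_N) : injective f ->
  onwires f (1%:M : 'M[C]_(qdim k)) = 1%:M.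
Proof.
move=> f_inj; apply: mx_bits2P => x y.
rewrite onwiresE !mxE !(inj_eq (@rank_inj _)).
have [->|xy] := eqVneq x y; first by rewrite agree_off_refl eqxx.
case: ifP => // a; case: eqP => // e; case/eqP: xy.
exact: agree_restr_eq a e.
Qed.

Lemma onwires_adj k N (f : 'I_k -> 'I_N) (g : 'M[C]_(qdim k)) :
  (onwires f g)^t* = onwires f (g^t*).
Proof.
apply: mx_bits2P => x y; rewrite [RHS]onwiresE agree_off_sym.
rewrite [LHS]mxE [X in _ X = _]mxE onwiresE.
by case: ifP => _; rewrite ?conjC0 // !mxE.
Qed.

Lemma onwires_unitary k N (f : 'I_k -> 'I_N) (g : 'M[C]_(qdim k)) :
  injective f -> g \is unitarymx -> onwires f g \is unitarymx.
Proof.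
move=> f_inj /unitarymxP gg; apply/unitarymxP.
by rewrite onwires_adj -onwiresM // gg onwires1.
Qed.

Lemma onwires_comp k l N (f : 'I_l -> 'I_N) (h : 'I_k -> 'I_l)
    (g : 'M[C]_(qdim k)) : injective f -> injective h ->
  onwires f (onwires h g) = onwires (f \o h) g.
Proof.
move=> f_inj h_inj; apply: mx_bits2P => x y; rewrite !onwiresE.
have rr z : restr h (restr f z) = restr (f \o h) z.
  by apply/ffunP => a; rewrite !ffunE.
rewrite !rr; have -> : agree_off (f \o h) x y =
    agree_off f x y && agree_off h (restr f x) (restr f y).
  apply/agree_offP/andP => [xy|[/agree_offP xy /agree_offP xy'] q qf].
    split; apply/agree_offP => q qf.
      by apply: xy; apply: contra qf => /codomP[a ->]; exact: codom_f.
    rewrite !ffunE; apply: xy; apply: contra qf => /codomP[a /f_inj ->].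
    exact: codom_f.
  have [/codomP[a qa]|/xy //] := boolP (q \in codom f).
  have := xy' a; rewrite !ffunE -qa; apply; apply: contra qf => /codomP[b ab].
  by rewrite qa ab; apply: (codom_f (f \o h)).
by case: (agree_off f x y).
Qed.

Lemma eq_onwires k N (f f' : 'I_k -> 'I_N) (g : 'M[C]_(qdim k)) :
  f =1 f' -> onwires f g = onwires f' g.
Proof.
move=> ff; apply: mx_bits2P => x y; rewrite !onwiresE.
have rr z : restr f z = restr f' z by apply/ffunP => a; rewrite !ffunE ff.
by rewrite !rr /agree_off (eq_codom ff).
Qed.

(* |0^a>|y> *)
Definition pad a k (y : {ffun 'I_k -> bool}) : {ffun 'I_(a + k) -> bool} :=
  [ffun q : 'I_(a + k) => match split q with inl _ => false | inr r => y r end].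

Lemma pad_l a k y (i : 'I_a) : @pad a k y (lshift k i) = false.
Proof. by rewrite ffunE; case: split_ordP => // j /eqP; rewrite eq_shift. Qed.

Lemma pad_r a k y (i : 'I_k) : @pad a k y (rshift a i) = y i.
Proof.
rewrite ffunE; case: split_ordP => j /eqP; rewrite eq_shift //.
by move/eqP ->.
Qed.

Lemma eq_pad a k x y : (x == @pad a k y) =
  (restr (@rshift a k) x == y) && [forall i, ~~ x (lshift k i)].
Proof.
apply/eqP/andP => [->|[/eqP <- /forallP x0]].
  split; first by apply/eqP/ffunP => i; rewrite ffunE pad_r.
  by apply/forallP => i; rewrite pad_l.
apply/ffunP => q; case: (split_ordP q) => j ->; last by rewrite pad_r ffunE.
by rewrite pad_l (negPf (x0 j)).
Qed.

Lemma restr_pad a k y : restr (@rshift a k) (pad a y) = y.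
Proof. by apply/ffunP => i; rewrite ffunE pad_r. Qed.

Lemma pad_inj a k : injective (@pad a k).
Proof. exact: can_inj (@restr_pad a k). Qed.

Lemma anc0E a k x j : anc0 C a k (rank x) j = (x == pad a (bits j))%:R.
Proof. by rewrite mxE rankK. Qed.

Lemma mul_anc0 a k p (A : 'M[C]_(p, qdim (a + k))) i y :
  (A *m anc0 C a k) i (rank y) = A i (rank (pad a y)).
Proof.
rewrite mxE sum_bits (bigD1 (pad a y)) //= anc0E rankK eqxx mulr1.
rewrite big1 ?addr0 // => x /negPf xy.
by rewrite anc0E rankK xy mulr0.
Qed.

Lemma anc0_mul a k p (A : 'M[C]_(qdim k, p)) x j :
  (anc0 C a k *m A) (rank x) j =
  if x == pad a (restr (@rshift a k) x)
  then A (rank (restr (@rshift a k) x)) j else 0.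
Proof.
rewrite mxE sum_bits; case: ifPn => [/eqP e|xe].
  rewrite (bigD1 (restr (@rshift a k) x)) //= anc0E rankK -e eqxx mul1r.
  rewrite big1 ?addr0 // => y yx; rewrite anc0E rankK e (inj_eq (@pad_inj _ _)).
  by rewrite eq_sym (negPf yx) mul0r.
rewrite big1 // => y _; rewrite anc0E rankK.
case: eqP => [xy|]; last by rewrite mul0r.
by case/eqP: xe; rewrite {1}xy -{1}(restr_pad a y) -xy.
Qed.

Lemma anc0_isometry a k : (anc0 C a k)^t* *m anc0 C a k = 1%:M.
Proof.
apply: mx_bits2P => x y; rewrite mul_anc0 !mxE rankK rankK -!/(pad a _).
by rewrite conjC_nat (inj_eq (@pad_inj _ _)) !(inj_eq (@rank_inj _)) eq_sym.
Qed.

(** An operator that leaves the first w wires alone commutes with adjoining zeros there. This lifts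
    circuits to registers with work qubits, and also carries U_I past the ancillas. *)
Lemma onwires_anc0 w k N (f : 'I_k -> 'I_N) (g : 'M[C]_(qdim k)) :
  onwires (@rshift w N \o f) g *m anc0 C w N = anc0 C w N *m onwires f g.
Proof.
apply: mx_bits2P => x y; rewrite mul_anc0 anc0_mul !onwiresE.
have rr z : restr (@rshift w N \o f) z = restr f (restr (@rshift w N) z).
  by apply/ffunP => a; rewrite !ffunE.
rewrite !rr restr_pad.
have -> : agree_off (@rshift w N \o f) x (pad w y) =
    (x == pad w (restr (@rshift w N) x)) &&
    agree_off f (restr (@rshift w N) x) y.
  apply/agree_offP/andP => [xy|[/eqP ex /agree_offP xy] q].
    split.
      rewrite eq_pad eqxx; apply/forallP => i; rewrite xy ?pad_l //.
      by apply/codomP => -[a] /eqP; rewrite eq_shift.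
    apply/agree_offP => q qf; rewrite ffunE xy ?pad_r //.
    by apply: contra qf => /codomP[a /rshift_inj ->]; rewrite codom_f.
  case: (split_ordP q) => j -> jf; first by rewrite ex !pad_l.
  rewrite pad_r -xy ?ffunE //; apply: contra jf => /codomP[a ->].
  exact: (codom_f (@rshift w N \o f)).
by case: (x == _).
Qed.

Lemma anc0_ket0 a k : anc0 C a k *m ket0 C k = ket0 C (a + k).
Proof.
apply: mx_bitsP => x j; rewrite anc0_mul !mxE ord1 eqxx !andbT.
rewrite !(inj_eq (@rank_inj _)).
have e : pad a [ffun=> false] = [ffun=> false] :> {ffun 'I_(a + k) -> bool}.
  by apply/ffunP => q; rewrite !ffunE; case: split => // b; rewrite ffunE.
have [->|x0] := eqVneq x [ffun=> false].
  have -> : restr (@rshift a k) [ffun=> false] = [ffun=> false].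
    by apply/ffunP => q; rewrite !ffunE.
  by rewrite e !eqxx.
case: eqP => // xe; case: eqP => // re; case/eqP: x0.
by rewrite xe re e.
Qed.

Lemma ket0_norm n : (ket0 C n)^t* *m ket0 C n = 1%:M.
Proof.
rewrite /ket0; apply/matrixP => i j.
rewrite mxE (bigD1 (rank [ffun=> false])) //=.
rewrite !mxE !ord1 !eqxx /= rmorph1 mulr1 big1 ?addr0 // => l /negPf le.
by rewrite !mxE le mulr0.
Qed.

End Embeddings.

(** * Controlled, diagonal and permutation operators *)

Section ControlledDiagonalPermutation.
Variable C : numClosedFieldType.

Lemma adjmxM m n p (A : 'M[C]_(m, n)) (B : 'M[C]_(n, p)) :
  (A *m B)^t* = B^t* *m A^t*.
Proof. by rewrite trmx_mul map_mxM. Qed.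

Lemma adjmxK m n (A : 'M[C]_(m, n)) : A^t*^t* = A.
Proof. by apply/matrixP => i j; rewrite !mxE conjCK. Qed.

Lemma unitary_adjmul n (U : 'M[C]_n) : U \is unitarymx -> U^t* *m U = 1%:M.
Proof. by move=> /unitarymxP /mulmx1C. Qed.

Lemma unit_mulC_conj (z : C) : `|z| = 1 -> z * z^* = 1.
Proof. by move=> z1; rewrite -normCK z1 expr1n. Qed.

(** Only the rows of [A] agreeing with x off [f] enter. A controlled factor can thus be replaced by
    its branch for the control value found in x, provided that the control is not among the wires
    [f]. *)
Lemma onwires_mul_row k N (f : 'I_k -> 'I_N) (g : 'M[C]_(qdim k)) p
    (A B : 'M[C]_(qdim N, p)) x j : injective f ->
  (forall y, agree_off f x y -> A (rank y) j = B (rank y) j) ->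
  (onwires f g *m A) (rank x) j = (onwires f g *m B) (rank x) j.
Proof.
move=> f_inj AB; rewrite !onwires_mulE //.
by apply: eq_bigr => u _; rewrite AB // agree_upd.
Qed.

Definition dg N (phi : {ffun 'I_N -> bool} -> C) : 'M[C]_(qdim N) :=
  \matrix_(i, j) (phi (bits i) *+ (i == j)).

Lemma dg_mulE N phi p (A : 'M[C]_(qdim N, p)) x j :
  (dg phi *m A) (rank x) j = phi x * A (rank x) j.
Proof.
rewrite mxE (bigD1 (rank x)) //= mxE rankK eqxx big1 ?addr0 // => y yx.
by rewrite mxE eq_sym (negPf yx) mul0r.
Qed.

Lemma mul_dgE N phi p (A : 'M[C]_(p, qdim N)) i y :
  (A *m dg phi) i (rank y) = A i (rank y) * phi y.
Proof.
rewrite mxE (bigD1 (rank y)) //= mxE rankK eqxx big1 ?addr0 // => x xy.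
by rewrite mxE (negPf xy) mulr0.
Qed.

Lemma dgE N (phi : {ffun 'I_N -> bool} -> C) x y :
  dg phi (rank x) (rank y) = phi x *+ (x == y).
Proof. by rewrite mxE rankK (inj_eq (@rank_inj _)). Qed.

Lemma eq_dg N (phi phi' : {ffun 'I_N -> bool} -> C) :
  phi =1 phi' -> dg phi = dg phi'.
Proof. by move=> e; apply: mx_bits2P => x y; rewrite !dgE e. Qed.

Lemma dgM N (phi phi' : {ffun 'I_N -> bool} -> C) :
  dg phi *m dg phi' = dg (fun x => phi x * phi' x).
Proof. by apply: mx_bits2P => x y; rewrite dg_mulE !dgE mulrnAr. Qed.

Lemma dg_unitary N (phi : {ffun 'I_N -> bool} -> C) :
  dg phi \is unitarymx <-> (forall x, `|phi x| = 1).
Proof.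
have adj : (dg phi)^t* = dg (fun x => (phi x)^*).
  apply: mx_bits2P => x y; rewrite [LHS]mxE [X in _ X = _]mxE !dgE rmorphMn /=.
  by rewrite eq_sym; case: eqP => // ->.
have one : dg (fun=> 1) = 1%:M :> 'M[C]_(qdim N).
  by apply: mx_bits2P => x y; rewrite dgE mxE (inj_eq (@rank_inj _)).
split=> [/unitarymxP|phi1].
  rewrite adj dgM -one => /matrixP e x; have := e (rank x) (rank x).
  rewrite !dgE eqxx -normCK => /eqP; rewrite sqrf_eq1 => /orP[/eqP //|/eqP h].
  by have := normr_ge0 (phi x); rewrite h oppr_ge0 ler10.
apply/unitarymxP; rewrite adj dgM -one; apply: eq_dg => x.
exact: unit_mulC_conj.
Qed.

Lemma onwires_dg k N (f : 'I_k -> 'I_N) (phi : {ffun 'I_k -> bool} -> C) :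
  injective f -> onwires f (dg phi) = dg (fun x => phi (restr f x)).
Proof.
move=> f_inj; apply: mx_bits2P => x y; rewrite onwiresE !dgE.
have [->|xy] := eqVneq x y; first by rewrite agree_off_refl eqxx.
case: ifP => // a; case: eqP => // e; case/eqP: xy.
exact: agree_restr_eq a e.
Qed.

Definition pmx N (s : {ffun 'I_N -> bool} -> {ffun 'I_N -> bool}) :
  'M[C]_(qdim N) := \matrix_(i, j) (bits i == s (bits j))%:R.

Lemma pmxE N s x y : @pmx N s (rank x) (rank y) = (x == s y)%:R.
Proof. by rewrite mxE !rankK. Qed.

Lemma mul_pmxE N s p (A : 'M[C]_(p, qdim N)) i y :
  (A *m pmx s) i (rank y) = A i (rank (s y)).
Proof.
rewrite mxE sum_bits (bigD1 (s y)) //= pmxE eqxx mulr1 big1 ?addr0 // => x xy.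
by rewrite pmxE (negPf xy) mulr0.
Qed.

Lemma pmx_mulE N s p (A : 'M[C]_(qdim N, p)) x j : involutive s ->
  (pmx s *m A) (rank x) j = A (rank (s x)) j.
Proof.
move=> ss; rewrite mxE sum_bits (bigD1 (s x)) //= pmxE ss eqxx mul1r.
rewrite big1 ?addr0 // => y; rewrite pmxE => xy.
by rewrite -(inv_eq ss) eq_sym (negPf xy) mul0r.
Qed.

Lemma pmxM N (s t : {ffun 'I_N -> bool} -> {ffun 'I_N -> bool}) :
  pmx s *m pmx t = pmx (s \o t).
Proof. by apply: mx_bits2P => x y; rewrite mul_pmxE !pmxE. Qed.

Lemma eq_pmx N (s t : {ffun 'I_N -> bool} -> {ffun 'I_N -> bool}) :
  s =1 t -> pmx s = pmx t.
Proof. by move=> e; apply: mx_bits2P => x y; rewrite !pmxE e. Qed.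

Lemma pmx_id N s : s =1 id -> @pmx N s = 1%:M.
Proof.
by move=> e; apply: mx_bits2P => x y; rewrite pmxE mxE e (inj_eq (@rank_inj _)).
Qed.

Lemma pmx_unitary N s : involutive s -> @pmx N s \is unitarymx.
Proof.
move=> ss; apply/unitarymxP; have -> : (pmx s)^t* = pmx s.
  apply: mx_bits2P => x y; rewrite [LHS]mxE [X in _ X = _]mxE !pmxE conjC_nat.
  by rewrite -(inv_eq ss) eq_sym.
by rewrite pmxM pmx_id.
Qed.

Lemma pmx_dg N s (phi : {ffun 'I_N -> bool} -> C) : involutive s ->
  pmx s *m dg phi *m pmx s = dg (phi \o s).
Proof.
move=> ss; apply: mx_bits2P => x y; rewrite mul_pmxE pmx_mulE // !dgE.
by rewrite (inj_eq (inv_inj ss)).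
Qed.

(** When [h] ignores wire t, this is the NOT on t controlled by the predicate [h]; CNOT, Toffoli and
    multi-controlled NOT are all instances. *)
Definition tog N (t : 'I_N) (h : {ffun 'I_N -> bool} -> bool)
    (x : {ffun 'I_N -> bool}) : {ffun 'I_N -> bool} :=
  [ffun q => if q == t then x q (+) h x else x q].

Lemma togE N (t : 'I_N) h x q :
  tog t h x q = if q == t then x q (+) h x else x q.
Proof. by rewrite ffunE. Qed.

Lemma tog_inv N (t : 'I_N) h : (forall x, h (tog t h x) = h x) ->
  involutive (tog t h).
Proof.
move=> ht x; apply/ffunP => q; rewrite !togE ht.
by case: eqP => //; rewrite addbK.
Qed.

Lemma onwires_tog k N (f : 'I_k -> 'I_N) t h : injective f ->
  onwires f (pmx (tog t h)) = pmx (tog (f t) (fun x => h (restr f x))).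
Proof.
move=> f_inj; apply: mx_bits2P => x y; rewrite onwiresE !pmxE.
set y' := tog (f t) _ y.
have <- : restr f y' = tog t h (restr f y).
  by apply/ffunP => q; rewrite !(togE, ffunE) (inj_eq f_inj).
have yy : agree_off f y y'.
  apply/agree_offP => q qf; rewrite togE; case: eqP => // e.
  by rewrite e codom_f in qf.
rewrite agree_off_sym (agree_off_trans _ yy).
have [->|xy] := eqVneq x y'; first by rewrite agree_off_refl eqxx.
case: ifP => // a; case: eqP => // e; case/eqP: xy.
by apply: (agree_restr_eq f_inj) e; rewrite agree_off_sym.
Qed.

Definition cwire k : 'I_(1 + k) := lshift k ord0.

Lemma agree_off_rshift k (x y : {ffun 'I_(1 + k) -> bool}) :
  agree_off (@rshift 1 k) x y = (x (cwire k) == y (cwire k)).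
Proof.
apply/agree_offP/eqP => [-> //|xy q].
  by apply/codomP => -[a] /eqP; rewrite eq_shift.
case: (split_ordP q) => a ->; first by rewrite ord1.
by rewrite codom_f.
Qed.

Lemma ctrlmxE k (U : 'M[C]_(qdim k)) x j :
  ctrlmx U (rank x) j =
  if x (cwire k) then onwires (@rshift 1 k) U (rank x) j
  else (1%:M : 'M[C]_(qdim (1 + k))) (rank x) j.
Proof.
rewrite -(bitsK j); move: (bits j) => y; rewrite onwiresE !mxE !rankK.
rewrite agree_off_rshift -!/(restr (@rshift 1 k) _).
rewrite !(inj_eq (@rank_inj _)).
rewrite -/(cwire k) /= (inj_eq (@rank_inj _)).
case x1: (x (cwire k)) => //=.
have [<-|nxy] := eqVneq x y; first by rewrite x1 !eqxx.
case: ifP => // /eqP e; case: (restr _ x =P restr _ y) => // e'.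
case/eqP: nxy; apply: (agree_restr_eq (@rshift_inj 1 k)) e'.
by rewrite agree_off_rshift x1 e.
Qed.

Lemma ctrlmx_mulE k (U : 'M[C]_(qdim k)) p (A : 'M[C]_(_, p)) x j :
  (ctrlmx U *m A) (rank x) j =
  if x (cwire k) then (onwires (@rshift 1 k) U *m A) (rank x) j
  else A (rank x) j.
Proof.
rewrite mxE; under eq_bigr => i _ do rewrite ctrlmxE.
case: ifP => _; first by rewrite mxE.
by rewrite -[in RHS](mul1mx A) mxE.
Qed.

Lemma ctrlmxM k (U V : 'M[C]_(qdim k)) :
  ctrlmx (U *m V) = ctrlmx U *m ctrlmx V.
Proof.
apply: mx_bitsP => x j; rewrite ctrlmx_mulE !ctrlmxE.
case: ifP => // x1; rewrite onwiresM; last exact: rshift_inj.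
apply: onwires_mul_row => [|y]; first exact: rshift_inj.
by rewrite agree_off_rshift ctrlmxE x1 => /eqP <-.
Qed.

Lemma ctrlmx1 k : ctrlmx (1%:M : 'M[C]_(qdim k)) = 1%:M.
Proof.
apply: mx_bitsP => x j; rewrite ctrlmxE onwires1 ?if_same //.
exact: rshift_inj.
Qed.

Lemma ctrlmx_adj k (U : 'M[C]_(qdim k)) : (ctrlmx U)^t* = ctrlmx (U^t*).
Proof.
apply/matrixP => i j; rewrite [LHS]mxE [X in _ X = _]mxE !mxE /=.
rewrite [bits j _ == _]eq_sym; case: eqP => [->|_]; last exact: conjC0.
by case: ifP => _; [rewrite !mxE|rewrite conjC_nat eq_sym].
Qed.

Lemma ctrlmx_unitary k (U : 'M[C]_(qdim k)) :
  U \is unitarymx -> ctrlmx U \is unitarymx.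
Proof.
move=> /unitarymxP UU; apply/unitarymxP.
by rewrite ctrlmx_adj -ctrlmxM UU ctrlmx1.
Qed.

Definition under_ctrl k N (f : 'I_k -> 'I_N) (i : 'I_(1 + k)) : 'I_(1 + N) :=
  match split i with inl a => lshift N a | inr b => rshift 1 (f b) end.

Lemma under_ctrl_l k N (f : 'I_k -> 'I_N) : under_ctrl f (cwire k) = cwire N.
Proof.
by rewrite /under_ctrl; case: split_ordP => // j; rewrite ord1.
Qed.

Lemma under_ctrl_r k N (f : 'I_k -> 'I_N) i :
  under_ctrl f (rshift 1 i) = rshift 1 (f i).
Proof.
rewrite /under_ctrl; case: split_ordP => j /eqP; rewrite eq_shift //.
by move=> /eqP ->.
Qed.

Lemma under_ctrl_inj k N (f : 'I_k -> 'I_N) :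
  injective f -> injective (under_ctrl f).
Proof.
move=> f_inj i j; case: (split_ordP i) => a ->; case: (split_ordP j) => b ->.
- by rewrite !ord1.
- by rewrite ord1 under_ctrl_l under_ctrl_r => /eqP; rewrite eq_shift.
- by rewrite ord1 under_ctrl_l under_ctrl_r => /eqP; rewrite eq_shift.
by rewrite !under_ctrl_r => /rshift_inj /f_inj ->.
Qed.

Lemma ctrlmx_onwires k N (f : 'I_k -> 'I_N) (g : 'M[C]_(qdim k)) :
  injective f -> ctrlmx (onwires f g) = onwires (under_ctrl f) (ctrlmx g).
Proof.
move=> f_inj; have uf := under_ctrl_inj f_inj.
have r_inj l := @rshift_inj 1 l.
apply: mx_bits2P => x y; rewrite ctrlmxE [RHS]onwiresE ctrlmxE.
rewrite [restr _ _ (cwire k)]ffunE under_ctrl_l; case: ifP => _.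
  rewrite -(onwiresE (under_ctrl f)) !onwires_comp //.
  rewrite (@eq_onwires _ _ _ (under_ctrl f \o @rshift 1 k)
    (@rshift 1 N \o f)) //.
  by move=> i /=; rewrite under_ctrl_r.
by rewrite -(onwiresE (under_ctrl f)) onwires1.
Qed.

Lemma ctrlmx_tog k (t : 'I_k) h : ctrlmx (pmx (tog t h)) =
  pmx (tog (rshift 1 t) (fun x => x (cwire k) && h (restr (@rshift 1 k) x))).
Proof.
apply: mx_bits2P => x y; rewrite ctrlmxE onwires_tog; last exact: rshift_inj.
have out z g : tog (rshift 1 t) g z (cwire k) = z (cwire k).
  by rewrite togE eq_shift.
rewrite !pmxE mxE (inj_eq (@rank_inj _)).
have [xy|xy] := eqVneq (x (cwire k)) (y (cwire k)); last first.
  have F g : (x == tog (rshift 1 t) g y) = false.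
    by apply: contra_neqF xy => /eqP ->; rewrite out.
  have F' : (x == y) = false by apply: contra_neqF xy => /eqP ->.
  by rewrite !F F' if_same.
have <- : (if y (cwire k)
    then tog (rshift 1 t) (fun z => h (restr (@rshift 1 k) z)) y else y) =
  tog (rshift 1 t) (fun z => z (cwire k) && h (restr (@rshift 1 k) z)) y.
  apply/ffunP => q; rewrite [RHS]togE; case: ifP => y1; first by rewrite togE.
  by rewrite addbF if_same.
by rewrite xy; case: ifP.
Qed.

Lemma ctrlmx_dg k (phi : {ffun 'I_k -> bool} -> C) : ctrlmx (dg phi) =
  dg (fun x => if x (cwire k) then phi (restr (@rshift 1 k) x) else 1).
Proof.
apply: mx_bits2P => x y; rewrite ctrlmxE onwires_dg; last exact: rshift_inj.
by rewrite !dgE mxE (inj_eq (@rank_inj _)); case: ifP.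
Qed.

(** When the control is off, V and its adjoint cancel, so only the middle factor needs the control.
    Diagonalising a gate thus reduces its controlled version to controlled phases. *)
Lemma ctrlmx_conj k (V D : 'M[C]_(qdim k)) : V \is unitarymx ->
  ctrlmx (V^t* *m D *m V) =
  onwires (@rshift 1 k) (V^t*) *m ctrlmx D *m onwires (@rshift 1 k) V.
Proof.
move=> uV; have r_inj := @rshift_inj 1 k.
apply: mx_bitsP => x j; rewrite ctrlmxE -[in RHS]mulmxA.
set A := ctrlmx D *m _; rewrite (@onwires_mul_row _ _ _ _ _ A (
  if x (cwire k) then onwires (@rshift 1 k) D *m onwires (@rshift 1 k) V
  else onwires (@rshift 1 k) V)) //.
  case: ifP => _; rewrite -!onwiresM // ?mulmxA //.
  by rewrite unitary_adjmul // onwires1.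
move=> y; rewrite agree_off_rshift => /eqP ->.
by rewrite ctrlmx_mulE; case: ifP.
Qed.

End ControlledDiagonalPermutation.

(** * Circuits with one- and two-qubit gates *)

Section Computing.
Variables (C : numClosedFieldType) (m n : nat).
Variables (UH : 'M[C]_(qdim (m + n))) (UI : 'M[C]_(qdim n)).

(** The counts are upper bounds, so that costs add along products and can be weakened. No work
    qubits are involved: the circuit equals [V] on every state. *)
Definition computes N (V : 'M[C]_(qdim N)) (g a b : nat) : Prop :=
  exists c : circuit C m n N,
  [/\ circuit_mx UH UI c = V, (gates c <= g)%N,
      (queries HamOracle c <= a)%N & (queries PrepOracle c <= b)%N].

Lemma circuit_mx_cat N (c1 c2 : circuit C m n N) :
  circuit_mx UH UI (c1 ++ c2) = circuit_mx UH UI c2 *m circuit_mx UH UI c1.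
Proof.
elim: c1 => [|i c1 IH] /=; first by rewrite mulmx1.
by rewrite IH mulmxA.
Qed.

Lemma computes1 N : computes (1%:M : 'M[C]_(qdim N)) 0 0 0.
Proof. by exists [::]. Qed.

Lemma computesM N (V1 V2 : 'M[C]_(qdim N)) g1 a1 b1 g2 a2 b2 :
  computes V1 g1 a1 b1 -> computes V2 g2 a2 b2 ->
  computes (V1 *m V2) (g1 + g2) (a1 + a2) (b1 + b2).
Proof.
move=> [c1 [<- hg1 ha1 hb1]] [c2 [<- hg2 ha2 hb2]]; exists (c2 ++ c1).
rewrite circuit_mx_cat /gates /queries !count_cat.
by split=> //; rewrite addnC leq_add.
Qed.

Lemma computes_le N (V : 'M[C]_(qdim N)) g a b g' a' b' :
  computes V g a b -> (g <= g')%N -> (a <= a')%N -> (b <= b')%N ->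
  computes V g' a' b'.
Proof.
move=> [c [cV hg ha hb]] gg aa bb; exists c.
by split=> //; apply: leq_trans; eassumption.
Qed.

Lemma computes_gate N k (f : 'I_k -> 'I_N) (g : 'M[C]_(qdim k)) :
  injective f -> (0 < k <= 2)%N -> g \is unitarymx ->
  computes (onwires f g) 1 0 0.
Proof.
move=> f_inj k2 gU; exists [:: Gate m n k2 gU f_inj].
by split; rewrite /= ?mul1mx.
Qed.

Lemma computes_query N o b (f : 'I_(oarity m n o) -> 'I_N) : injective f ->
  computes (onwires f (oracle_mx UH UI o b)) 0
    (oracle_eqb HamOracle o) (oracle_eqb PrepOracle o).
Proof.
move=> f_inj; exists [:: Query C b f_inj].
by split; rewrite /= ?mul1mx //; case: (o).
Qed.

Lemma computes_cquery N o b (f : 'I_(1 + oarity m n o) -> 'I_N) :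
  injective f ->
  computes (onwires f (ctrlmx (oracle_mx UH UI o b))) 0
    (oracle_eqb HamOracle o) (oracle_eqb PrepOracle o).
Proof.
move=> f_inj; exists [:: CQuery C b f_inj].
by split; rewrite /= ?mul1mx //; case: (o).
Qed.

Section Inverse.
Hypotheses (UHu : UH \is unitarymx) (UIu : UI \is unitarymx).

Lemma oracle_unit o b : oracle_mx UH UI o b \in unitmx.
Proof. by case: o; case: b => /=; rewrite ?unitmx_inv unitarymx_unit. Qed.

Lemma oracle_inv o b :
  oracle_mx UH UI o (~~ b) *m oracle_mx UH UI o b = 1%:M.
Proof.
have := oracle_unit o false; case: o; case: b => /= h; rewrite ?mulVmx //.
  by rewrite mulmxV.
by rewrite mulmxV.
Qed.

Definition inv_instr N (i : instr C m n N) : instr C m n N :=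
  match i with
  | Gate _ g _ k2 gU f_inj =>
      Gate m n k2 (etrans (trmxC_unitary g) gU : is_true _) f_inj
  | Query _ b _ f_inj => Query C (~~ b) f_inj
  | CQuery _ b _ f_inj => CQuery C (~~ b) f_inj
  end.

Lemma inv_instrK N (i : instr C m n N) :
  instr_mx UH UI (inv_instr i) *m instr_mx UH UI i = 1%:M.
Proof.
case: i => [k g f k2 gU f_inj|o b f f_inj|o b f f_inj] /=; rewrite -onwiresM //.
- by rewrite unitary_adjmul // onwires1.
- by rewrite oracle_inv onwires1.
- by rewrite -ctrlmxM oracle_inv ctrlmx1 onwires1.
Qed.

(** Reverse the list and invert each instruction; the inverse of an instruction is one of the same
    kind, so no count changes. *)
Lemma computes_inv N (V : 'M[C]_(qdim N)) g a b :
  computes V g a b -> V \in unitmx /\ computes (invmx V) g a b.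
Proof.
move=> [c [<- hg ha hb]]; pose c' := rev (map (@inv_instr N) c).
have cc : circuit_mx UH UI c' *m circuit_mx UH UI c = 1%:M.
  rewrite /c'; elim: (c) => [|i d IH]; first by rewrite mulmx1.
  rewrite map_cons rev_cons -cats1 circuit_mx_cat /= mul1mx mulmxA.
  by rewrite -[_ *m _ *m circuit_mx UH UI d]mulmxA IH mulmx1 inv_instrK.
have [_ cu] := mulmx1_unit cc; split=> //; exists c'; split.
- by rewrite -[LHS](mulmxK cu) cc mul1mx.
- rewrite /gates count_rev count_map; apply: leq_trans hg.
  by rewrite leq_eqVlt; apply/orP; left; apply/eqP/eq_count; case.
- rewrite /queries count_rev count_map; apply: leq_trans ha.
  by rewrite leq_eqVlt; apply/orP; left; apply/eqP/eq_count; case.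
rewrite /queries count_rev count_map; apply: leq_trans hb.
by rewrite leq_eqVlt; apply/orP; left; apply/eqP/eq_count; case.
Qed.

End Inverse.

Lemma computes_onwires_gate M N (F : 'I_M -> 'I_N) k (h : 'I_k -> 'I_M)
    (g : 'M[C]_(qdim k)) :
  injective F -> injective h -> (0 < k <= 2)%N -> g \is unitarymx ->
  computes (onwires F (onwires h g)) 1 0 0.
Proof.
move=> F_inj h_inj k2 gU; rewrite onwires_comp //.
by apply: computes_gate => //; apply: inj_comp.
Qed.

Lemma tnth2_inj N (a b : 'I_N) : a != b -> injective (tnth [tuple a; b]).
Proof. by move=> ab; apply/tuple_uniqP; rewrite /= inE ab. Qed.

Definition cnot (p : bool -> bool) : 'M[C]_(qdim 2) :=
  pmx C (tog (lift ord0 ord0) (fun v : {ffun 'I_2 -> bool} => p (v ord0))).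

Lemma cnot_unitary p : cnot p \is unitarymx.
Proof. by apply/pmx_unitary/tog_inv => x; rewrite togE. Qed.

(** A unitary is normal, hence unitarily diagonalisable; conjugating back shows that the diagonal
    factor is unitary, so its entries are phases. *)
Lemma unitary_spectral k (g : 'M[C]_(qdim k)) : g \is unitarymx ->
  exists (V : 'M[C]_(qdim k)) (d : {ffun 'I_k -> bool} -> C),
  [/\ V \is unitarymx, forall x, `|d x| = 1 & g = V^t* *m dg d *m V].
Proof.
move=> gU; have gn : g \is normalmx.
  by apply/normalmxP; rewrite (unitarymxP gU) unitary_adjmul.
have Pu := spectral_unitarymx g; pose d x := spectral_diag g 0 (rank x).
exists (spectralmx g), d.
have ge : g = (spectralmx g)^t* *m dg d *m spectralmx g.
  rewrite -invmx_unitary //; have -> : dg d = diag_mx (spectral_diag g).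
    by apply/matrixP => i j; rewrite !mxE /d bitsK.
  exact/orthomx_spectralP.
split=> //; apply/dg_unitary.
have -> : dg d = spectralmx g *m g *m (spectralmx g)^t*.
  rewrite {2}ge !mulmxA (unitarymxP Pu) mul1mx -mulmxA (unitarymxP Pu).
  by rewrite mulmx1.
by rewrite mul_unitarymx ?trmxC_unitary // mul_unitarymx.
Qed.

(* With D x y the eigenphases and s ^+ 2 = D11 D00 / (D10 D01), the identity
   2 x y = x + y - (x (+) y) gives D x y as D00 * (D10 / D00 * s) ^ x *
   (D01 / D00 * s) ^ y * s ^ - (x (+) y), whose controlled factors each act
   on two qubits. *)
Lemma computes_ctrl_gate N (F : 'I_(1 + 2) -> 'I_N) (g : 'M[C]_(qdim 2)) :
  injective F -> g \is unitarymx -> computes (onwires F (ctrlmx g)) 7 0 0.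
Proof.
move=> F_inj /unitary_spectral [V [d [VU d1 ->]]].
rewrite ctrlmx_conj // ctrlmx_dg.
pose D (x y : bool) := d [ffun i : 'I_2 => if i == ord0 then x else y].
have D1 x y : `|D x y| = 1 by exact: d1.
have D0 x y : D x y != 0 by rewrite -normr_eq0 D1 oner_eq0.
pose s := sqrtC (D true true * D false false / (D true false * D false true)).
have ss : s ^+ 2 = D true true * D false false / (D true false * D false true).
  exact: sqrtCK.
have s1 : `|s| = 1.
  apply/eqP; rewrite -(@eqrXn2 _ 2) // expr1n -normrX ss.
  by rewrite !(normrM, normfV, D1, mulr1, invr1).
have s0 : s != 0 by rewrite -normr_eq0 s1 oner_eq0.
pose A (c x : bool) :=
  if c then (if x then D true false * s else D false false) else 1.
pose B (c y : bool) :=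
  if c && y then D false true / D false false * s else 1.
pose E (c z : bool) := if c && z then s^-1 else 1.
pose ph (f : bool -> bool -> C) :=
  dg (fun v : {ffun 'I_2 -> bool} => f (v ord0) (v (lift ord0 ord0))).
have phU f : (forall x y, `|f x y| = 1) -> ph f \is unitarymx.
  by move=> f1; apply/dg_unitary.
have AU : ph A \is unitarymx.
  by apply: phU => -[] []; rewrite /A /= ?normrM ?D1 ?s1 ?normr1 ?mulr1.
have BU : ph B \is unitarymx.
  apply: phU => -[] []; rewrite /B /= ?normr1 //.
  by rewrite !normrM normfV !D1 s1 invr1 !mulr1.
have EU : ph E \is unitarymx.
  by apply: phU => -[] []; rewrite /E /= ?normr1 // normfV s1 invr1.
pose w0 : 'I_3 := ord0; pose w1 : 'I_3 := lift ord0 ord0.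
pose w2 : 'I_3 := lift ord0 (lift ord0 ord0).
pose h01 := tnth [tuple w0; w1]; pose h02 := tnth [tuple w0; w2].
pose h12 := tnth [tuple w1; w2].
have i01 : injective h01 by exact: tnth2_inj.
have i02 : injective h02 by exact: tnth2_inj.
have i12 : injective h12 by exact: tnth2_inj.
(* Conjugation by the CNOT from [w1] to [w2] makes [E] read the parity of the two data bits. With
   [V] and its adjoint outside, this amounts to the seven gates of the bound. *)
have -> : dg (fun x : {ffun 'I_(1 + 2) -> bool} =>
      if x (cwire 2) then d (restr (@rshift 1 2) x) else 1) =
    onwires h01 (ph A) *m onwires h02 (ph B) *m
    (onwires h12 (cnot id) *m onwires h02 (ph E) *m onwires h12 (cnot id)).
  rewrite [onwires h12 _]onwires_tog // !onwires_dg // pmx_dg; last first.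
    by apply: tog_inv => x; rewrite !ffunE.
  rewrite !dgM; apply: eq_dg => x; rewrite /= !ffunE.
  have -> : cwire 2 = w0 by apply/val_inj.
  have -> : d (restr (@rshift 1 2) x) = D (x w1) (x w2).
    congr d; apply/ffunP => i; rewrite !ffunE.
    case: ifP => [/eqP ->|i0]; first by congr (x _); apply/val_inj.
    by congr (x _); apply/val_inj; case: i i0 => -[|[|]].
  rewrite /h01 /h02 /h12 /A /B /E !(tnth_nth w0) /=.
  case: (x w0) => /=; last by rewrite !mulr1.
  case: (x w1); case: (x w2); rewrite /= ?mulr1.
  - transitivity (D true false * D false true / D false false * s ^+ 2).
      by rewrite ss; field; rewrite !D0.
    by field; rewrite D0.
  - by rewrite mulfK.
  - by field; rewrite D0 s0.
  - by [].
rewrite !onwiresM //.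
have r_inj : injective (@rshift 1 2) by exact: rshift_inj.
have two h k' : injective h -> k' \is unitarymx ->
    computes (onwires F (onwires (h : 'I_2 -> 'I_(1 + 2)) k')) 1 0 0.
  by move=> h_inj k'U; apply: computes_onwires_gate.
have cU := cnot_unitary id.
have VaU : V^t* \is unitarymx by rewrite trmxC_unitary.
apply: (computes_le (computesM (computesM (two _ _ r_inj VaU)
  (computesM (computesM (two _ _ i01 AU) (two _ _ i02 BU))
  (computesM (computesM (two _ _ i12 cU) (two _ _ i02 EU)) (two _ _ i12 cU))))
  (two _ _ r_inj VU))) => //.
Qed.

End Computing.

(** * Multi-controlled NOT by ladders of Toffoli gates on borrowed wires *)

Section Ladder.
Variable N : nat.
Implicit Types (x y : {ffun 'I_N -> bool}) (cs ds : seq 'I_N).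

Definition zeros cs x : bool := all (fun c => ~~ x c) cs.

Lemma eq_zeros cs x y : {in cs, x =1 y} -> zeros cs x = zeros cs y.
Proof. by move=> xy; apply: eq_in_all => c /xy ->. Qed.

(* Toggles each wire of ds when a suffix of cs is zero.  A second ladder on the
   tails undoes the toggles of all wires but the first (ladder_mcx), so that
   these wires are only borrowed: they may hold any value and get it back
   (Barenco et al., 1995). *)
Fixpoint ladder cs ds : {ffun 'I_N -> bool} -> {ffun 'I_N -> bool} :=
  match cs, ds with
  | c :: cs', a :: ds' =>
      if ds' is a' :: _ then
        tog a (fun x => x a' && ~~ x c) \o ladder cs' ds' \o
        tog a (fun x => x a' && ~~ x c)
      else tog a (fun x => ~~ x c)
  | _, _ => id
  end.

(** The two toggles of [a] read [a'] before and after the inner ladder. Their sum is the zero test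
    of [c] times the change of [a'], so [a] receives the toggle of [a'] with one more control,
    whatever value [a'] holds. *)
Lemma ladderE cs ds x q : size cs = size ds -> uniq (cs ++ ds) ->
  ladder cs ds x q =
  if q \in ds then x q (+) zeros (drop (index q ds) cs) x else x q.
Proof.
elim: cs ds x q => [|c cs IH] [|a ds] x q //= [sz].
rewrite mem_cat inE !negb_or => /andP[/and3P[ccs ca cds]].
rewrite cat_uniq => /and3P[csU /=]; rewrite negb_or => /andP[acs dis].
move=> /andP[ads dsU].
have IHU : uniq (cs ++ ds) by rewrite cat_uniq csU dis dsU.
case: ds => [|a' ds] in IH sz cds dis ads dsU IHU *.
  case: cs => // in sz csU ccs IH acs dis IHU *.
  rewrite togE inE eq_sym; case: (eqVneq a q) => //= _.
  by rewrite andbT.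
set T := tog a _; set y := T x.
have yT z b : b != a -> T z b = z b by rewrite togE => /negPf ->.
have TE z : T z a = z a (+) (z a' && ~~ z c) by rewrite togE eqxx.
have a'a : a' != a by move: ads; rewrite inE negb_or eq_sym => /andP[].
have cb b : b \in cs -> y b = x b.
  by move=> bcs; rewrite yT //; apply: contraNneq acs => <-.
rewrite /= -/y -/T inE eq_sym.
have [->|qa] := eqVneq q a; last first.
  rewrite yT // IH //=; case: ifP => qds; rewrite ?yT //.
  by congr (_ (+) _); apply: eq_zeros => b /mem_drop /cb.
rewrite TE (IH _ _ a) // (IH _ _ a') // (negPf ads) mem_head /= eqxx drop0.
have -> : ladder cs (a' :: ds) y c = x c.
  by rewrite IH // (negPf cds) yT.
rewrite (eq_zeros cb) /y (yT _ a') // TE.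
by case: (x a); case: (x a'); case: (x c); case: (zeros cs x).
Qed.

Lemma ladder_mcx c cs a ds x : size cs = size ds -> uniq (c :: cs ++ a :: ds) ->
  ladder cs ds (ladder (c :: cs) (a :: ds) x) = tog a (zeros (c :: cs)) x.
Proof.
move=> sz U; set y := ladder _ _ x.
have U' : uniq (cs ++ ds).
  move: U => /= /andP[_]; rewrite !cat_uniq /= negb_or.
  by move=> /and3P[-> /andP[_ ->] /andP[_ ->]].
have sz' : size (c :: cs) = size (a :: ds) by rewrite /= sz.
have yE q : y q = _ := ladderE x q sz' U.
have ycs b : b \in cs -> y b = x b.
  move=> bcs; rewrite yE ifN //; move: U => /= /andP[_].
  by rewrite cat_uniq => /and3P[_ /hasPn h _]; apply: contraL bcs => /h.
apply/ffunP => q; rewrite togE ladderE //.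
have [->|qa] := eqVneq q a.
  rewrite ifN; first by rewrite yE mem_head /= eqxx.
  by move: U => /= /andP[_]; rewrite cat_uniq => /and3P[_ _ /= /andP[]].
case: ifP => qds; last by rewrite yE inE (negPf qa) qds.
rewrite yE inE (negPf qa) qds /= eq_sym (negPf qa) /=.
rewrite (@eq_zeros _ y x) ?addbK // => b /mem_drop; exact: ycs.
Qed.

End Ladder.

Section ComputingReflections.
Variables (C : numClosedFieldType) (m n : nat).
Variables (UH : 'M[C]_(qdim (m + n))) (UI : 'M[C]_(qdim n)).
Local Notation computes := (computes UH UI).

Lemma computes_cnot N (c t : 'I_N) p : c != t ->
  computes (pmx C (tog t (fun x => p (x c)))) 1 0 0.
Proof.
move=> ct; have f_inj := tnth2_inj ct.
have := computes_gate UH UI f_inj isT (cnot_unitary C p).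
rewrite onwires_tog //; congr (computes _ _ _ _); apply: eq_pmx => x.
by apply/ffunP => q; rewrite !togE ffunE.
Qed.

Lemma computes_toffoli N (a c t : 'I_N) p : uniq [:: a; c; t] ->
  computes (pmx C (tog t (fun x => x a && p (x c)))) 7 0 0.
Proof.
move=> U; have f_inj : injective (tnth [tuple a; c; t]) by apply/tuple_uniqP.
have := computes_ctrl_gate UH UI f_inj (cnot_unitary C p).
rewrite ctrlmx_tog onwires_tog //; congr (computes _ _ _ _); apply: eq_pmx => x.
apply/ffunP => q; rewrite !togE !ffunE !(tnth_nth a) /=.
by [].
Qed.

(** Every control but the last costs two Toffoli gates of 7 gates each, and the last one a CNOT: at
    most 14 gates per control. *)
Lemma computes_ladder N (cs ds : seq 'I_N) :
  size cs = size ds -> uniq (cs ++ ds) ->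
  computes (pmx C (ladder cs ds)) (14 * size cs) 0 0.
Proof.
elim: cs ds => [|c cs IH] [|a ds] //= => [_ _|[sz]].
  by rewrite pmx_id //; apply: computes1.
rewrite mem_cat inE !negb_or => /andP[/and3P[ccs ca cds]].
rewrite cat_uniq => /and3P[csU /=]; rewrite negb_or => /andP[acs dis].
move=> /andP[ads dsU].
have IHU : uniq (cs ++ ds) by rewrite cat_uniq csU dis dsU.
have := IH ds sz IHU.
case: ds => [|a' ds] in IH sz cds dis ads dsU IHU *.
  by move=> _; apply: computes_le (computes_cnot negb ca) _ _ _.
have T : computes (pmx C (tog a (fun x => x a' && ~~ x c))) 7 0 0.
  apply: computes_toffoli; rewrite /= !inE !negb_or.
  move: cds ads; rewrite !inE !negb_or => /andP[ca' _] /andP[aa' _].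
  by rewrite eq_sym ca' eq_sym aa' ca.
move=> L; have := computesM (computesM T L) T; rewrite !pmxM => TLT.
by apply: (computes_le TLT) => //; rewrite /=; lia.
Qed.

(** Two ladders, at 14 gates per control each. Besides the target they borrow one wire for each
    control but the first, taken from the front of [ds]. *)
Lemma computes_zeros N (cs ds : seq 'I_N) (a : 'I_N) :
  (0 < size cs <= (size ds).+1)%N -> uniq (cs ++ a :: ds) ->
  computes (pmx C (tog a (zeros cs))) (28 * size cs) 0 0.
Proof.
case: cs => // c cs; rewrite ltnS => sz U.
have sz' : size cs = size (take (size cs) ds) by rewrite size_takel.
have U' : uniq (c :: cs ++ a :: take (size cs) ds).
  apply: (subseq_uniq _ U); rewrite /= eqxx cat_subseq //= eqxx.
  exact: take_subseq.
have U'' : uniq (cs ++ take (size cs) ds).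
  apply: (subseq_uniq _ U').
  apply: (@subseq_trans _ (cs ++ a :: take (size cs) ds)).
    by rewrite cat_subseq // subseq_cons.
  exact: subseq_cons.
have sz2 : size (c :: cs) = size (a :: take (size cs) ds) by rewrite /= -sz'.
have := computesM (computes_ladder sz' U'')
  (computes_ladder sz2 U').
rewrite pmxM (@eq_pmx _ _ _ (tog a (zeros (c :: cs)))) => [h|x]; last first.
  exact: ladder_mcx.
by apply: (computes_le h) => //=; lia.
Qed.

End ComputingReflections.

(** * Operators realised with two clean work qubits: reflections and double controls *)

Section Realizing.
Variables (C : numClosedFieldType) (m n : nat).
Variables (UH : 'M[C]_(qdim (m + n))) (UI : 'M[C]_(qdim n)).
Local Notation computes := (computes UH UI).

(** [W] is prescribed only on work qubits in zero, where it must also leave them, so the same two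
    can be reused by every factor of a product. A reflection needs both of them, a doubly controlled
    query one. *)
Definition realizes N (V : 'M[C]_(qdim N)) (g a b : nat) : Prop :=
  exists2 W : 'M[C]_(qdim (2 + N)), computes W g a b &
    W *m anc0 C 2 N = anc0 C 2 N *m V.

Lemma realizes_le N (V : 'M[C]_(qdim N)) g a b g' a' b' :
  realizes V g a b -> (g <= g')%N -> (a <= a')%N -> (b <= b')%N ->
  realizes V g' a' b'.
Proof. by move=> [W cW WV] *; exists W => //; apply: computes_le cW _ _ _. Qed.

Lemma realizes1 N : realizes (1%:M : 'M[C]_(qdim N)) 0 0 0.
Proof. by exists 1%:M; [apply: computes1 | rewrite mul1mx mulmx1]. Qed.

Lemma realizesM N (V1 V2 : 'M[C]_(qdim N)) g1 a1 b1 g2 a2 b2 :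
  realizes V1 g1 a1 b1 -> realizes V2 g2 a2 b2 ->
  realizes (V1 *m V2) (g1 + g2) (a1 + a2) (b1 + b2).
Proof.
move=> [W1 c1 e1] [W2 c2 e2]; exists (W1 *m W2); first exact: computesM.
by rewrite -mulmxA e2 !mulmxA e1.
Qed.

Lemma realizesX N (V : 'M[C]_(qdim N)) g a b r : realizes V g a b ->
  realizes (V ^+ r) (r * g) (r * a) (r * b).
Proof.
move=> rV; elim: r => [|r IH]; first exact: realizes1.
by rewrite exprS !mulSn; apply: realizesM.
Qed.

Lemma realizes_inv N (V : 'M[C]_(qdim N)) g a b :
  UH \is unitarymx -> UI \is unitarymx -> V \in unitmx ->
  realizes V g a b -> realizes (invmx V) g a b.
Proof.
move=> UHu UIu Vu [W cW WV]; have [Wu cWi] := computes_inv UHu UIu cW.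
exists (invmx W) => //; rewrite -[X in invmx W *m X](mulmxK Vu) -WV.
by rewrite !mulmxA mulVmx // mul1mx.
Qed.

Lemma realizes_onwires k N (f : 'I_k -> 'I_N) (V : 'M[C]_(qdim k)) g a b :
  computes (onwires (@rshift 2 N \o f) V) g a b ->
  realizes (onwires f V) g a b.
Proof. by move=> h; eexists; [exact: h | rewrite onwires_anc0]. Qed.

(** The reflection 2 P - I, where P projects onto the strings that vanish on [ws]. *)
Definition refl0 N (ws : seq 'I_N) : 'M[C]_(qdim N) :=
  dg (fun x => if zeros ws x then 1 else -1).

Lemma dg_anc0 w N (phi : {ffun 'I_(w + N) -> bool} -> C) :
  dg phi *m anc0 C w N = anc0 C w N *m dg (fun y => phi (pad w y)).
Proof.
apply: mx_bits2P => x y; rewrite dg_mulE mul_dgE !anc0E !rankK.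
by case: eqP => [->|_]; rewrite ?mulr0 ?mul0r // mulrC.
Qed.

(* Each half of ws serves as borrowed wires for the test that the other half is
   zero, so that two work qubits suffice for a linear gate count. *)
Lemma realizes_refl0 N (ws : seq 'I_N) : uniq ws -> (1 < size ws)%N ->
  realizes (refl0 ws) (56 * size ws + 1) 0 0.
Proof.
move=> U sz; pose h := (size ws)./2.
pose A := map (@rshift 2 N) (take h ws).
pose B := map (@rshift 2 N) (drop h ws).
pose a : 'I_(2 + N) := lshift N ord0.
pose b : 'I_(2 + N) := lshift N (lift ord0 ord0).
have sA : size A = h by rewrite size_map size_takel // /h; lia.
have sB : size B = (size ws - h)%N by rewrite size_map size_drop.
have AB : uniq (A ++ B).
  by rewrite -map_cat cat_take_drop map_inj_uniq //; apply: rshift_inj.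
have notin (i : 'I_2) s : lshift N i \notin map (@rshift 2 N) s.
  by apply/mapP => -[j _ /eqP]; rewrite eq_shift.
have UA : uniq (A ++ a :: B).
  by rewrite uniq_catC /= mem_cat negb_or !notin uniq_catC.
have UB : uniq (B ++ b :: A).
  by rewrite uniq_catC /= mem_cat negb_or !notin.
(* The halves have sizes h and h or h + 1, so each has enough wires to lend to the test of the
   other; both are nonempty because [1 < size ws]. *)
have cA : computes (pmx C (tog a (zeros A))) (28 * size A) 0 0.
  by apply: computes_zeros UA; rewrite sA sB /h; lia.
have cB : computes (pmx C (tog b (zeros B))) (28 * size B) 0 0.
  by apply: computes_zeros UB; rewrite sA sB /h; lia.
have ab : a != b by rewrite (inj_eq (@lshift_inj _ _)).
pose z (v : {ffun 'I_2 -> bool}) : C :=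
  if v ord0 && v (lift ord0 ord0) then 1 else -1.
have zU : dg z \is unitarymx.
  by apply/dg_unitary => v; rewrite /z; case: ifP; rewrite ?normrN normr1.
have cZ := computes_gate UH UI (tnth2_inj ab) isT zU.
have invo (t : 'I_(2 + N)) cs : t \notin cs -> involutive (tog t (zeros cs)).
  move=> tcs; apply: tog_inv => x; apply: eq_zeros => c ccs.
  by rewrite togE; case: eqP => // e; rewrite -e ccs in tcs.
have cW := computesM (computesM cA (computesM (computesM cB cZ) cB)) cA.
eexists; first by apply: (computes_le cW) => //; rewrite sA sB /h; lia.
rewrite (onwires_dg _ (tnth2_inj ab)) !pmx_dg ?dg_anc0; try exact/invo/notin.
congr (_ *m _); apply: eq_dg => y; rewrite /z /=.
rewrite ![restr _ _ _]ffunE !(tnth_nth a) /=.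
have zBa x : zeros B (tog a (zeros A) x) = zeros B x.
  apply: eq_zeros => q qB; rewrite togE.
  by case: eqP qB (notin ord0 (drop h ws)) => // -> ->.
rewrite [tog b _ _ b]togE eqxx zBa [tog b _ _ a]togE (negPf ab) !togE eqxx.
rewrite [b == a]eq_sym (negPf ab) !pad_l !addFb.
have zp s : zeros (map (@rshift 2 N) s) (pad 2 y) = zeros s y.
  by rewrite /zeros all_map; apply: eq_all => i /=; rewrite pad_r.
rewrite -[in RHS](cat_take_drop h ws) /zeros all_cat -!/(zeros _ _).
by rewrite -!zp.
Qed.

Lemma onwires_ctrlmxE k N (f : 'I_(1 + k) -> 'I_N) (U : 'M[C]_(qdim k)) x j :
  injective f -> onwires f (ctrlmx U) (rank x) j =
  if x (f (cwire k)) then onwires (f \o @rshift 1 k) U (rank x) j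
  else (1%:M : 'M[C]_(qdim N)) (rank x) j.
Proof.
move=> f_inj; rewrite -(bitsK j); move: (bits j) => y.
rewrite onwiresE ctrlmxE [restr _ _ (cwire k)]ffunE.
case: (x (f (cwire k))); last first.
  by rewrite -(onwiresE f) onwires1.
by rewrite -(onwiresE f) onwires_comp //; apply: rshift_inj.
Qed.

Lemma onwires_ctrlmx_mulE k N (f : 'I_(1 + k) -> 'I_N) (U : 'M[C]_(qdim k))
    p (A : 'M[C]_(_, p)) x j :
  injective f -> (onwires f (ctrlmx U) *m A) (rank x) j =
  if x (f (cwire k)) then (onwires (f \o @rshift 1 k) U *m A) (rank x) j
  else A (rank x) j.
Proof.
move=> f_inj; rewrite mxE; under eq_bigr => i _ do rewrite onwires_ctrlmxE //.
case: ifP => _; first by rewrite mxE.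
by rewrite -[in RHS](mul1mx A) mxE.
Qed.

(* A Toffoli gate writes the conjunction of the two controls in a work qubit,
   which then controls U and is reset by the same gate. *)
Lemma realizes_double_ctrl k N (F : 'I_(1 + (1 + k)) -> 'I_N)
    (U : 'M[C]_(qdim k)) a b :
  injective F ->
  (forall G : 'I_(1 + k) -> 'I_(2 + N), injective G ->
     computes (onwires G (ctrlmx U)) 0 a b) ->
  realizes (onwires F (ctrlmx (ctrlmx U))) 14 a b.
Proof.
move=> F_inj cU; pose t : 'I_(2 + N) := lshift N ord0.
pose F0 := F (cwire (1 + k)); pose F1 := F (rshift 1 (cwire k)).
pose f i := F (rshift 1 (rshift 1 i)).
have f_inj : injective f by move=> i j /F_inj /rshift_inj /rshift_inj.
pose G (i : 'I_(1 + k)) : 'I_(2 + N) :=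
  match split i with inl _ => t | inr r => rshift 2 (f r) end.
have G0 : G (cwire k) = t.
  by rewrite /G; case: split_ordP => // j /eqP; rewrite eq_shift.
have Gr i : G (rshift 1 i) = rshift 2 (f i).
  by rewrite /G; case: split_ordP => j /eqP; rewrite eq_shift // => /eqP ->.
have G_inj : injective G.
  move=> i j; case: (split_ordP i) => i' ->; case: (split_ordP j) => j' ->.
  - by rewrite !ord1.
  - by rewrite ord1 G0 Gr => /eqP; rewrite eq_shift.
  - by rewrite ord1 G0 Gr => /eqP; rewrite eq_shift.
  by rewrite !Gr => /rshift_inj /f_inj ->.
pose hh (x : {ffun 'I_(2 + N) -> bool}) := x (rshift 2 F0) && x (rshift 2 F1).
have T : computes (pmx C (tog t hh)) 7 0 0.
  apply: (computes_toffoli _ _ id).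
  rewrite /= !inE !negb_or !eq_shift (inj_eq F_inj) eq_shift.
  by [].
exists (pmx C (tog t hh) *m onwires G (ctrlmx U) *m pmx C (tog t hh)).
  by apply: (computes_le (computesM (computesM T (cU G G_inj)) T)); lia.
set s := tog t hh; have ss : involutive s.
  by apply: tog_inv => x; rewrite /hh !togE !eq_shift.
apply: mx_bitsP => x j; rewrite -!mulmxA pmx_mulE // onwires_ctrlmx_mulE //.
rewrite G0 (eq_onwires (f' := @rshift 2 N \o f) _ Gr).
have sT : s x t = x t (+) hh x by rewrite togE eqxx.
(* [U] acts away from the flag [t] and from both controls, so the toggle [s] passes through it and
   its two copies cancel. *)
have -> : (onwires (@rshift 2 N \o f) U *m (pmx C s *m anc0 C 2 N))
    (rank (s x)) j
    = (anc0 C 2 N *m onwires f U) (rank x) j.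
  have rf_inj : injective (@rshift 2 N \o f) by move=> p q /rshift_inj /f_inj.
  rewrite -onwires_anc0 !onwires_mulE //; apply: eq_bigr => u _.
  have out i : (forall l, i != rshift 2 (f l)) ->
      i \notin codom (@rshift 2 N \o f).
    by move=> h; apply/codomP => -[l] /eqP; rewrite (negPf (h l)).
  have t_out : t \notin codom (@rshift 2 N \o f).
    by apply: out => l; rewrite eq_shift.
  have hh_upd y v : hh (upd (@rshift 2 N \o f) y v) = hh y.
    rewrite /hh !upd_out //; apply: out => l; rewrite eq_shift (inj_eq F_inj).
      by rewrite eq_shift.
    by rewrite !eq_shift.
  have -> : restr (@rshift 2 N \o f) (s x) = restr (@rshift 2 N \o f) x.
    by apply/ffunP => i; rewrite ffunE togE eq_shift ffunE.
  suff -> : upd (@rshift 2 N \o f) (s x) u = s (upd (@rshift 2 N \o f) x u).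
    by rewrite pmx_mulE // ss.
  apply/ffunP => q; rewrite [RHS]togE hh_upd.
  have [/codomP[i ->]|qf] := boolP (q \in codom (@rshift 2 N \o f)).
    by rewrite !upd_in // eq_shift.
  by rewrite !upd_out // togE.
rewrite pmx_mulE // ss sT -[in X in if _ then _ else X](mulmx1 (anc0 C 2 N)).
rewrite !anc0_mul.
case: eqP => [xp|_]; last by rewrite if_same.
have -> : x t = false by rewrite xp pad_l.
rewrite onwires_ctrlmxE // onwires_ctrlmxE; last first.
  exact: inj_comp F_inj (@rshift_inj _ _).
rewrite /= /hh /F0 /F1 !ffunE.
by case: (x _) => //=; case: (x _).
Qed.

End Realizing.

Section SingleQubit.
Variable C : numClosedFieldType.

Lemma sum_bits1 (V : nmodType) (F : {ffun 'I_1 -> bool} -> V) :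
  \sum_x F x = F [ffun=> true] + F [ffun=> false].
Proof.
rewrite (reindex (fun b : bool => [ffun=> b] : {ffun 'I_1 -> bool})) /=.
  by rewrite big_bool.
exists (fun x : {ffun 'I_1 -> bool} => x ord0) => x _; first by rewrite ffunE.
by apply/ffunP => i; rewrite ffunE (ord1 i).
Qed.

Lemma eq_bits1 (x y : {ffun 'I_1 -> bool}) : (x == y) = (x ord0 == y ord0).
Proof.
apply/eqP/eqP => [-> //|xy]; apply/ffunP => i.
by rewrite (ord1 i).
Qed.

Definition mx1 (f : bool -> bool -> C) : 'M[C]_(qdim 1) :=
  \matrix_(i, j) f (bits i ord0) (bits j ord0).

Lemma mx1_unitary f :
  (forall x y,
     f x true * (f y true)^* + f x false * (f y false)^* = (x == y)%:R) ->
  mx1 f \is unitarymx.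
Proof.
move=> fU; apply/unitarymxP/mx_bits2P => x y.
rewrite mxE sum_bits sum_bits1 !mxE !rankK !ffunE fU.
by rewrite (inj_eq (@rank_inj _)) eq_bits1.
Qed.

Lemma hadamard_unitary : hadamard C \is unitarymx.
Proof.
apply: (@mx1_unitary (fun x y => (-1) ^+ (x && y) / sqrtC 2)) => x y.
have s2 : (sqrtC 2)^-1 * (sqrtC 2)^-1 = 2^-1 :> C.
  by rewrite -invfM -expr2 sqrtCK.
have re (b : bool) : ((-1) ^+ b / sqrtC 2 : C)^* = (-1) ^+ b / sqrtC 2.
  apply: conj_Creal; rewrite rpredM ?rpredX ?rpredN ?rpred1 // rpredV.
  by rewrite ger0_real // sqrtC_ge0 ler0n.
rewrite !re ![_ / _ * (_ / _)]mulrACA s2.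
by case: x; case: y; rewrite /= ?expr0 ?expr1; field.
Qed.

End SingleQubit.

(** * The amplitude amplification circuit *)

Section RealizeAmplification.
Variables (C : numClosedFieldType) (m n : nat).
Variables (UH : 'M[C]_(qdim (m + n))) (UI : 'M[C]_(qdim n)).
Local Notation computes := (computes UH UI).
Local Notation realizes := (realizes UH UI).

Lemma realizes_gate N k (f : 'I_k -> 'I_N) (g : 'M[C]_(qdim k)) :
  injective f -> (0 < k <= 2)%N -> g \is unitarymx ->
  realizes (onwires f g) 1 0 0.
Proof.
move=> f_inj k2 gU; apply/realizes_onwires/computes_gate => //.
exact: inj_comp (@rshift_inj _ _) f_inj.
Qed.

(** The bound 14 is the worst of four cases: a controlled one-qubit gate is a single gate, a
    controlled two-qubit gate takes 7, a query becomes a controlled query at no gate, and a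
    controlled query takes two Toffoli gates. *)
Lemma realizes_ctrl_instr M N (F : 'I_(1 + M) -> 'I_N) (i : instr C m n M) :
  injective F ->
  realizes (onwires F (ctrlmx (instr_mx UH UI i))) 14
    (is_query HamOracle i) (is_query PrepOracle i).
Proof.
move=> F_inj; have r_inj := @rshift_inj 2 N.
case: i => [k g f k2 gU f_inj|o b f f_inj|o b f f_inj] /=;
  have uf := under_ctrl_inj f_inj;
  have Fu := inj_comp F_inj uf;
  rewrite ctrlmx_onwires // onwires_comp //.
- have rF := inj_comp r_inj Fu.
  case: k => [|[|[|k]]] // in g f k2 gU f_inj uf Fu rF *.
    apply: (@realizes_le _ _ _ _ _ _ _ 1 0 0) => //; apply: realizes_gate => //.
    exact: ctrlmx_unitary.
  apply: (@realizes_le _ _ _ _ _ _ _ 7 0 0) => //; apply: realizes_onwires.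
  exact: computes_ctrl_gate.
- apply: (@realizes_le _ _ _ _ _ _ _ 0 _ _ _ _ _ _ _ (leqnn _) (leqnn _)) => //.
  apply: realizes_onwires; apply: computes_cquery.
  exact: inj_comp r_inj Fu.
apply: realizes_double_ctrl => // G G_inj; exact: computes_cquery.
Qed.

(** The gate bound involves [size c] rather than [gates c], since adding a control to a query may
    itself cost gates. *)
Lemma realizes_ctrl_circuit M N (F : 'I_(1 + M) -> 'I_N) (c : circuit C m n M) :
  injective F ->
  realizes (onwires F (ctrlmx (circuit_mx UH UI c))) (14 * size c)
    (queries HamOracle c) (queries PrepOracle c).
Proof.
move=> F_inj; elim: c => [|i c IH] /=.
  by rewrite ctrlmx1 onwires1 //; apply: realizes1.
rewrite ctrlmxM onwiresM //.
apply: (realizes_le (realizesM IH (realizes_ctrl_instr i F_inj)));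
  by rewrite /queries /=; lia.
Qed.

Lemma size_circuit N (c : circuit C m n N) :
  size c = (gates c + queries HamOracle c + queries PrepOracle c)%N.
Proof.
elim: c => [//|i c IH]; rewrite /gates /queries /= IH /gates /queries.
by case: i => [k g f k2 gU f_inj|[] b f f_inj|[] b f f_inj] /=; lia.
Qed.

(** The sign of the iterate is paid for as a scalar one-qubit gate, so the circuit equals the
    operator exactly and not only up to a global phase. *)
Lemma realizes_opp N (f : 'I_1 -> 'I_N) (V : 'M[C]_(qdim N)) g a b :
  injective f -> realizes V g a b -> realizes (- V) (1 + g) a b.
Proof.
move=> f_inj rV; have -> : - V = onwires f (dg (fun=> -1)) *m V.
  by apply: mx_bitsP => x j; rewrite onwires_dg // dg_mulE mxE mulN1r.
apply: (realizesM (a1 := 0) (b1 := 0)) rV; apply: realizes_gate => //.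
by apply/dg_unitary => x; rewrite normrN1.
Qed.

Lemma S_chiE : S_chi C m n = refl0 C (map (@lshift m.+4 n) (enum 'I_m.+4)).
Proof.
apply: mx_bits2P => x y.
have -> : S_chi C m n (rank x) (rank y) =
    2 * (anc0 C m.+4 n *m (anc0 C m.+4 n)^t*) (rank x) (rank y) - (x == y)%:R.
  by rewrite /S_chi; move: (_ *m _) => J; rewrite !mxE (inj_eq (@rank_inj _)).
rewrite dgE anc0_mul !mxE !rankK -/(pad m.+4 _).
have -> : zeros (map (@lshift m.+4 n) (enum 'I_m.+4)) x =
    (x == pad m.+4 (restr (@rshift m.+4 n) x)).
  rewrite eq_pad eqxx /zeros all_map; apply/allP/forallP => h i.
    by apply: h; rewrite mem_enum.
  by rewrite [preim _ _ _]h.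
have [<-|xp] := eqVneq x (pad _ _).
  rewrite eq_sym conjC_nat; case: eqP => _; rewrite ?mulr1n ?mulr0n; ring.
by case: (x == y); rewrite ?mulr1n ?mulr0n; ring.
Qed.

Lemma S_zeroE : S_zero C m n = refl0 C (enum 'I_(m.+4 + n)).
Proof.
apply: mx_bits2P => x y; rewrite dgE !mxE big_ord1 !mxE !(inj_eq (@rank_inj _)).
have -> : zeros (enum 'I_(m.+4 + n)) x = (x == [ffun=> false]).
  rewrite /zeros; apply/allP/eqP => [h|-> i _]; last by rewrite ffunE.
  by apply/ffunP => i; rewrite ffunE; apply/negbTE/h; rewrite mem_enum.
rewrite eqxx !andbT conjC_nat.
have [->|x0] := eqVneq x [ffun=> false].
  rewrite eq_sym; case: eqP => _; rewrite ?mulr1n ?mulr0n; ring.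
by case: (x == y); rewrite ?mulr1n ?mulr0n; ring.
Qed.

Hypotheses (UHu : UH \is unitarymx) (UIu : UI \is unitarymx).
Variables (US : 'M[C]_(qdim (m.+2 + n))) (cS : circuit C m n (m.+2 + n)).
Variable B : 'M[C]_(qdim 1).
Hypotheses (USu : US \is unitarymx) (Bu : B \is unitarymx).
Hypothesis cSE : circuit_mx UH UI cS = US.

Lemma Utheta_unitary : Utheta US \is unitarymx.
Proof.
have hU : onwires (@lshift 1 (m.+2 + n)) (hadamard C) \is unitarymx.
  by apply: onwires_unitary (hadamard_unitary C); apply: lshift_inj.
by rewrite !mul_unitarymx ?ctrlmx_unitary.
Qed.

Lemma exact_prep_unitary : exact_prep B (aa_prep US UI) \is unitarymx.
Proof.
rewrite /exact_prep /aa_prep; apply: mul_unitarymx.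
  apply: onwires_unitary; first exact: (@rshift_inj 1 (m.+3 + n)).
  apply: mul_unitarymx Utheta_unitary _; apply: onwires_unitary => //.
  exact: rshift_inj.
by apply: onwires_unitary => //; apply: lshift_inj.
Qed.

(** The 3 gates beyond the controlled U_S are the two Hadamards and [B]; the extra query is U_I. *)
Lemma realizes_exact_prep : realizes (exact_prep B (aa_prep US UI))
  (14 * size cS + 3) (queries HamOracle cS) (queries PrepOracle cS + 1).
Proof.
have r1 := @rshift_inj 1 (m.+3 + n).
have r3 := @rshift_inj m.+3 n.
have l1 := @lshift_inj 1 (m.+3 + n).
have l1' := @lshift_inj 1 (m.+2 + n).
rewrite /exact_prep /aa_prep /Utheta !onwiresM // !onwires_comp //.
have rh : realizes (onwires (@rshift 1 (m.+3 + n) \o @lshift 1 (m.+2 + n))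
    (hadamard C)) 1 0 0.
  by apply: realizes_gate (hadamard_unitary C) => //; apply: inj_comp r1 l1'.
have rB := realizes_gate l1 isT Bu.
have rS := realizes_ctrl_circuit cS r1; rewrite cSE in rS.
have rI : realizes (onwires (@rshift 1 (m.+3 + n) \o @rshift m.+3 n) UI) 0 0 1.
  apply: realizes_onwires.
  apply: (computes_query UH UI (o := PrepOracle) false).
  exact: inj_comp (@rshift_inj _ _) (inj_comp r1 r3).
by apply: (realizes_le
  (realizesM (realizesM (realizesM (realizesM rh rS) rh) rI) rB)); lia.
Qed.

(** One iterate consists of the preparation and its inverse, reflections on m + 4 + n and on m + 4
    wires at 56 gates per wire plus 1 each, and 1 gate for the sign. The preparation is thus used 2
    r + 1 times in all. *)
Lemma realizes_amplify r : realizes (amplify B US UI r)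
  (r * (2 * (14 * size cS + 3) + 112 * (m + 4) + 56 * n + 3) +
   (14 * size cS + 3))
  ((2 * r + 1) * queries HamOracle cS)
  ((2 * r + 1) * (queries PrepOracle cS + 1)).
Proof.
have rA := realizes_exact_prep; have Au := unitarymx_unit exact_prep_unitary.
have rAi := realizes_inv UHu UIu Au rA.
have rz : realizes (S_zero C m n) (56 * (m.+4 + n) + 1) 0 0.
  rewrite S_zeroE -[X in (56 * X)%N]size_enum_ord; apply: realizes_refl0.
    exact: enum_uniq.
  by rewrite size_enum_ord.
have rc : realizes (S_chi C m n) (56 * m.+4 + 1) 0 0.
  have sz : size (map (@lshift m.+4 n) (enum 'I_m.+4)) = m.+4.
    by rewrite size_map size_enum_ord.
  rewrite S_chiE -[X in (56 * X)%N]sz.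
  apply: realizes_refl0; last by rewrite sz.
  by rewrite map_inj_uniq ?enum_uniq //; apply: lshift_inj.
have f_inj : injective (fun _ : 'I_1 => lshift n (ord0 : 'I_m.+4)).
  by move=> i j; rewrite !ord1.
have rQ := realizes_opp f_inj (realizesM (realizesM (realizesM rA rz) rAi) rc).
by apply: (realizes_le (realizesM (realizesX r rQ) rA)); nia.
Qed.

End RealizeAmplification.

(** * The amplified state *)

Section FirstQubit.
Variable C : numClosedFieldType.

Definition qcons k (u : {ffun 'I_1 -> bool}) (x : {ffun 'I_k -> bool}) :
    {ffun 'I_(1 + k) -> bool} :=
  [ffun q => match split q with inl a => u a | inr b => x b end].

Lemma qcons_l k u (x : {ffun 'I_k -> bool}) i : qcons u x (lshift k i) = u i.
Proof.
by rewrite ffunE; case: split_ordP => j /eqP; rewrite eq_shift // => /eqP ->.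
Qed.

Lemma qcons_r k u (x : {ffun 'I_k -> bool}) i : qcons u x (rshift 1 i) = x i.
Proof.
by rewrite ffunE; case: split_ordP => j /eqP; rewrite eq_shift // => /eqP ->.
Qed.

Lemma eq_on_split k (x y : {ffun 'I_(1 + k) -> bool}) :
  (forall i, x (lshift k i) = y (lshift k i)) ->
  (forall i, x (rshift 1 i) = y (rshift 1 i)) -> x = y.
Proof. by move=> xl xr; apply/ffunP => q; case: (split_ordP q) => j ->. Qed.

Lemma upd_lshift k u v (x : {ffun 'I_k -> bool}) :
  upd (@lshift 1 k) (qcons u x) v = qcons v x.
Proof.
apply: eq_on_split => i; first by rewrite upd_in ?qcons_l //; apply: lshift_inj.
rewrite upd_out ?qcons_r //.
by apply/codomP => -[a] /eqP; rewrite eq_shift.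
Qed.

Lemma upd_rshift k u (x y : {ffun 'I_k -> bool}) :
  upd (@rshift 1 k) (qcons u x) y = qcons u y.
Proof.
apply: eq_on_split => i; last by rewrite upd_in ?qcons_r //; apply: rshift_inj.
rewrite upd_out ?qcons_l //.
by apply/codomP => -[a] /eqP; rewrite eq_shift.
Qed.

Lemma restr_lshift_qcons k u (x : {ffun 'I_k -> bool}) :
  restr (@lshift 1 k) (qcons u x) = u.
Proof. by apply/ffunP => i; rewrite ffunE qcons_l. Qed.

Lemma restr_rshift_qcons k u (x : {ffun 'I_k -> bool}) :
  restr (@rshift 1 k) (qcons u x) = x.
Proof. by apply/ffunP => i; rewrite ffunE qcons_r. Qed.

Lemma pad1_qcons k (x : {ffun 'I_k -> bool}) : pad 1 x = qcons [ffun=> false] x.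
Proof.
by apply: eq_on_split => i; rewrite ?pad_l ?pad_r ?qcons_l ?qcons_r ?ffunE.
Qed.

Lemma anc01_qcons k u (x : {ffun 'I_k -> bool}) p (A : 'M[C]_(_, p)) j :
  (anc0 C 1 k *m A) (rank (qcons u x)) j = A (rank x) j *+ ~~ u ord0.
Proof.
rewrite anc0_mul restr_rshift_qcons; case: eqP => [e|ne].
  move/(congr1 (fun z : {ffun _} => z (lshift k ord0))): e.
  by rewrite pad_l qcons_l => ->; rewrite mulr1n.
case u0: (u ord0) => //; case: ne; rewrite pad1_qcons; congr qcons.
by apply/ffunP => i; rewrite ffunE (ord1 i).
Qed.

Lemma lshift_anc01 k (g : 'M[C]_(qdim 1)) u (x : {ffun 'I_k -> bool})
    p (A : 'M[C]_(_, p)) j :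
  (onwires (@lshift 1 k) g *m (anc0 C 1 k *m A)) (rank (qcons u x)) j =
  g (rank u) (rank [ffun=> false]) * A (rank x) j.
Proof.
rewrite onwires_mulE; last exact: lshift_inj.
rewrite sum_bits1 !upd_lshift !anc01_qcons restr_lshift_qcons !ffunE.
by rewrite mulr0 add0r.
Qed.

Lemma adj_anc0_mul a k p (A : 'M[C]_(_, p)) x j :
  ((anc0 C a k)^t* *m A) (rank x) j = A (rank (pad a x)) j.
Proof.
have adjE z : ((anc0 C a k)^t*) (rank x) (rank z) = (z == pad a x)%:R.
  by rewrite mxE mxE anc0E rankK conjC_nat.
rewrite mxE sum_bits (bigD1 (pad a x)) //= adjE eqxx mul1r.
rewrite big1 ?addr0 // => z zx.
by rewrite adjE (negPf zx) mul0r.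
Qed.

(** The two values of the control give the branches I and U, each weighted by 1 / sqrt 2 from both
    Hadamards. For U_S, which encodes -S, the block becomes (1 - S) / 2. *)
Lemma hadamard_test k (U : 'M[C]_(qdim k)) :
  let h := onwires (@lshift 1 k) (hadamard C) in
  (anc0 C 1 k)^t* *m (h *m ctrlmx U *m h) *m anc0 C 1 k = 2^-1 *: (1%:M + U).
Proof.
move=> h; rewrite -!mulmxA; apply: mx_bitsP => x j.
rewrite adj_anc0_mul pad1_qcons onwires_mulE; last exact: lshift_inj.
rewrite sum_bits1 !upd_lshift restr_lshift_qcons !ctrlmx_mulE !qcons_l !ffunE.
rewrite onwires_mulE; last exact: rshift_inj.
rewrite restr_rshift_qcons -[anc0 C 1 k]mulmx1.
under eq_bigr => v _ do rewrite upd_rshift lshift_anc01.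
rewrite lshift_anc01 !mxE !rankK !ffunE /= !expr0 !mul1r.
have s2 : (sqrtC 2)^-1 * (sqrtC 2)^-1 = 2^-1 :> C.
  by rewrite -invfM -expr2 sqrtCK.
have -> : \sum_v U (rank x) (rank v) *
      ((sqrtC 2)^-1 * (1%:M : 'M[C]_(qdim k)) (rank v) j) =
    (sqrtC 2)^-1 * U (rank x) j.
  under eq_bigr => v _ do rewrite mulrCA.
  rewrite -mulr_sumr; congr (_ * _).
  by rewrite -[in RHS](mulmx1 U) mxE sum_bits.
by rewrite !mulrA !s2 -mulrDr addrC.
Qed.

Lemma anc0_comp1 b k : anc0 C b.+1 k = anc0 C 1 (b + k) *m anc0 C b k.
Proof.
apply: mx_bits2P => x y; rewrite [RHS]mul_anc0 anc0E rankK.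
rewrite (@anc0E C 1 (b + k) x) rankK.
suff e : pad b.+1 y = pad 1 (pad b y) :> {ffun 'I_(1 + (b + k)) -> bool}.
  by rewrite -e.
apply: eq_on_split => i.
  rewrite pad_l ffunE; case: split_ordP => // j /(congr1 val) /=.
  by case: i => -[].
rewrite pad_r; case: (split_ordP i) => j ->.
  rewrite pad_l ffunE; case: split_ordP => // l /(congr1 val) /= e.
  by have := ltn_ord j; move: e; rewrite /=; lia.
rewrite pad_r ffunE; case: split_ordP => l /(congr1 val) /= e.
  by have := ltn_ord l; move: e; rewrite /=; lia.
by congr (y _); apply/val_inj => /=; lia.
Qed.

End FirstQubit.

(** * The rotation performed by one amplification iterate *)

Section AmplitudeAmplificationStep.
Variables (C : numClosedFieldType) (D d : nat).
Variables (A : 'M[C]_D) (k0 : 'cV[C]_D) (J : 'M[C]_(D, d)) (s2 : C).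
Hypotheses (Au : A \is unitarymx) (k0n : k0^t* *m k0 = 1%:M).
Hypothesis JJ : J^t* *m J = 1%:M.
Let psi := A *m k0.
Let good := J *m (J^t* *m psi).
Hypothesis goodE : (J^t* *m psi)^t* *m (J^t* *m psi) = s2%:M.

Let Q := - (A *m (2 *: (k0 *m k0^t*) - 1%:M) *m invmx A *m
            (2 *: (J *m J^t*) - 1%:M)).

(** The iterate is a product of reflections about [psi] and about the good subspace, so it preserves
    the span of [good] and [psi - good]. Leaving these two vectors unnormalised, with squared norms
    s2 and 1 - s2, keeps the coefficients free of divisions. *)
Lemma aa_iterateE (x y : C) :
  Q *m (x *: good + y *: (psi - good)) =
  (x * (1 - 2 * s2) + 2 * y * (1 - s2)) *: good +
  (y * (1 - 2 * s2) - 2 * x * s2) *: (psi - good).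
Proof.
have psipsi : psi^t* *m psi = 1%:M.
  by rewrite adjmxM mulmxA -[_ *m A]mulmxA unitary_adjmul // mulmx1.
have psigood : psi^t* *m good = s2%:M.
  by rewrite -goodE adjmxM adjmxK !mulmxA.
have refl : A *m (2 *: (k0 *m k0^t*) - 1%:M) *m invmx A =
    2 *: (psi *m psi^t*) - 1%:M.
  rewrite mulmxBr mulmxBl mulmx1 mulmxV ?unitarymx_unit // invmx_unitary //.
  by rewrite -scalemxAr -scalemxAl adjmxM !mulmxA.
have Jgood : J^t* *m good = J^t* *m psi by rewrite /good mulmxA JJ mul1mx.
have chi : (2 *: (J *m J^t*) - 1%:M) *m (x *: good + y *: (psi - good)) =
    x *: good - y *: (psi - good).
  have cg : (2 *: (J *m J^t*) - 1%:M) *m good = good.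
    rewrite mulmxBl mul1mx -scalemxAl -mulmxA Jgood -/good scaler_nat mulr2n.
    by rewrite addrK.
  have cb : (2 *: (J *m J^t*) - 1%:M) *m (psi - good) = - (psi - good).
    rewrite mulmxBl mul1mx -scalemxAl -mulmxA mulmxBr Jgood subrr mulmx0.
    by rewrite scaler0 sub0r.
  by rewrite mulmxDr -!scalemxAr cg cb scalerN.
rewrite /Q mulNmx refl -mulmxA chi mulmxBl mul1mx -scalemxAl -mulmxA.
have -> : psi^t* *m (x *: good - y *: (psi - good)) =
    (x * s2 - y * (1 - s2))%:M.
  rewrite mulmxBr -!scalemxAr mulmxBr psipsi psigood.
  by apply/matrixP => i j; rewrite !ord1 !mxE eqxx !mulr1n.
rewrite mul_mx_scalar scalerA.
have -> : psi = good + (psi - good) by rewrite addrC subrK.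
set b := psi - good; have -> : good + b - good = b by rewrite addrC addKr.
rewrite scalerDr; apply/matrixP => i j; rewrite !mxE.
by ring.
Qed.

(** For s2 = sin^2 theta the recurrences are the addition formulas satisfied by sin((2j+1) theta) /
    sin theta and cos((2j+1) theta) / cos theta. *)
Lemma aa_iterate_trig (c s : nat -> C) (r : nat) :
  (forall j, s j.+1 = s j * (1 - 2 * s2) + 2 * c j * (1 - s2)) ->
  (forall j, c j.+1 = c j * (1 - 2 * s2) - 2 * s j * s2) ->
  s 0 = 1 -> c 0 = 1 ->
  iter r (mulmx Q) psi = s r *: good + c r *: (psi - good).
Proof.
move=> sS cS s0 c0; elim: r => [|r IH].
  by rewrite s0 c0 !scale1r addrC subrK.
by rewrite iterS IH aa_iterateE sS cS.
Qed.

End AmplitudeAmplificationStep.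

Lemma onwires_id (C : numClosedFieldType) N (g : 'M[C]_(qdim N)) :
  onwires id g = g.
Proof.
apply: mx_bits2P => x y; rewrite onwiresE.
have rid z : restr id z = z by apply/ffunP => i; rewrite ffunE.
rewrite !rid ifT //; apply/agree_offP => q.
by rewrite (codom_f id q).
Qed.

(** * Squared norms and spectral expansions *)

Section Norms.
Variable R : realType.
Local Notation C := R[i].
Local Notation "x %:C" := (real_complex R x).

Lemma conj_real (x : R) : (x%:C)^* = x%:C.
Proof. by apply: conj_Creal; apply/complex_realP; exists x. Qed.

Lemma sqr_normcE (z : C) : (Normc.normc z ^+ 2)%:C = z^* * z.
Proof. by rewrite rmorphXn mulrC -normCK. Qed.

Lemma normc_real (x : R) : Normc.normc x%:C ^+ 2 = x ^+ 2.
Proof. by apply: (@complexI R); rewrite sqr_normcE conj_real rmorphXn. Qed.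

Definition nsq d (v : 'cV[C]_d) : R := \sum_i Normc.normc (v i 0) ^+ 2.

Lemma nsqE d (v : 'cV[C]_d) : v^t* *m v = (nsq v)%:C%:M.
Proof.
apply/matrixP => i j; rewrite !ord1 !mxE eqxx mulr1n rmorph_sum /=.
by apply: eq_bigr => k _; rewrite sqr_normcE !mxE.
Qed.

Lemma nsq_inj d1 d2 (v : 'cV[C]_d1) (w : 'cV[C]_d2) :
  v^t* *m v = w^t* *m w -> nsq v = nsq w.
Proof.
rewrite !nsqE => /matrixP/(_ 0 0); rewrite !mxE eqxx !mulr1n.
exact: complexI.
Qed.

Lemma nsq_ge0 d (v : 'cV[C]_d) : 0 <= nsq v.
Proof. by apply: sumr_ge0 => i _; apply: sqr_ge0. Qed.

Lemma nsqZ d (a : C) (v : 'cV[C]_d) : nsq (a *: v) = Normc.normc a ^+ 2 * nsq v.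
Proof.
rewrite /nsq mulr_sumr; apply: eq_bigr => i _.
by rewrite mxE Normc.normcM exprMn.
Qed.

Lemma nsq_isometry D d (U : 'M[C]_(D, d)) v :
  U^t* *m U = 1%:M -> nsq (U *m v) = nsq v.
Proof.
move=> UU; apply: nsq_inj.
by rewrite adjmxM mulmxA -[_ *m U]mulmxA UU mulmx1.
Qed.

Lemma nsq_proj d (P : 'M[C]_d) v : P^t* = P -> P *m P = P ->
  nsq v = nsq (P *m v) + nsq ((1%:M - P) *m v).
Proof.
move=> Ps PP; apply: (@complexI R); rewrite rmorphD /=.
suff : (nsq v)%:C%:M =
    (nsq (P *m v))%:C%:M + (nsq ((1%:M - P) *m v))%:C%:M :> 'M_1.
  by move/matrixP/(_ 0 0); rewrite !mxE eqxx !mulr1n.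
have adjB (x y : 'cV[C]_d) : (x - y)^t* = x^t* - y^t*.
  by apply/matrixP => i j; rewrite !mxE rmorphB.
have wv : (P *m v)^t* *m v = v^t* *m (P *m v) by rewrite adjmxM Ps -mulmxA.
have ww : (P *m v)^t* *m (P *m v) = v^t* *m (P *m v).
  by rewrite adjmxM Ps -mulmxA (mulmxA P) PP.
rewrite -!nsqE mulmxBl mul1mx adjB mulmxBl !mulmxBr wv ww.
by rewrite subrr subr0 addrC subrK.
Qed.

(** As [J] is isometric, the left side is the squared norm of the orthogonal projection of v onto
    the range of [J]. *)
Lemma nsq_coisometry D d (J : 'M[C]_(D, d)) v : J^t* *m J = 1%:M ->
  nsq (J^t* *m v) <= nsq v.
Proof.
move=> JJ; rewrite -(nsq_isometry (U := J)) // mulmxA.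
rewrite [leRHS](@nsq_proj _ (J *m J^t*)) ?lerDl ?nsq_ge0 //.
  by rewrite adjmxM adjmxK.
by rewrite mulmxA -[J *m _ *m J]mulmxA JJ mulmx1.
Qed.

Variables (d : nat) (H : 'M[C]_d) (psi : 'I_d -> 'cV[C]_d) (E : 'I_d -> R).
Hypothesis eig : orthonormal_eigenstates H psi E.

Lemma nsq_expand (beta : 'I_d -> C) :
  nsq (\sum_k beta k *: psi k) = \sum_k Normc.normc (beta k) ^+ 2.
Proof.
pose Psi : 'M[C]_d := \matrix_(i, k) psi k i 0.
have PP : Psi^t* *m Psi = 1%:M.
  apply/matrixP => j k; rewrite !mxE.
  have := eig.1 j k => /matrixP/(_ 0 0); rewrite !mxE eqxx mulr1n => <-.
  by apply: eq_bigr => i _; rewrite !mxE.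
have -> : \sum_k beta k *: psi k = Psi *m \col_k beta k.
  apply/matrixP => i j; rewrite summxE ord1 mxE; apply: eq_bigr => k _.
  by rewrite !mxE mulrC.
by rewrite nsq_isometry //; apply: eq_bigr => k _; rewrite mxE.
Qed.

Lemma nsq_psi k : nsq (psi k) = 1.
Proof.
apply: (@complexI R); have := eig.1 k k; rewrite nsqE eqxx.
by move=> /matrixP/(_ 0 0); rewrite !mxE eqxx !mulr1n rmorph1.
Qed.

Lemma polymx_eigen (S : {poly R}) (A : 'M[C]_d) (v : 'cV[C]_d) (x : R) :
  A *m v = x%:C *: v -> polymx S A *m v = (S.[x])%:C *: v.
Proof.
move=> Av; have AX i : A ^+ i *m v = (x ^+ i)%:C *: v.
  elim: i => [|i IH]; first by rewrite !expr0 mul1mx scale1r.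
  rewrite exprS -mulmxA IH -scalemxAr Av scalerA exprSr.
  by rewrite rmorphM.
rewrite /polymx mulmx_suml horner_coef rmorph_sum scaler_suml.
by apply: eq_bigr => i _; rewrite -scalemxAl AX scalerA rmorphM.
Qed.

Lemma shifted_eigen lam Lam k :
  ((lam + `|Lam|)^-1)%:C *: (H - (Lam%:C)%:M) *m psi k =
  ((E k - Lam) / (lam + `|Lam|))%:C *: psi k.
Proof.
rewrite -scalemxAl mulmxBl eig.2 mul_scalar_mx -scalerBl scalerA.
by congr (_ *: _); rewrite [in RHS]mulrC rmorphM rmorphB.
Qed.

(** Components with E k <= x lie in the range of [P] and are killed by 1 - P; on the remaining ones
    1 - P does not increase the norm. *)
Lemma orth_projector_contract P x (beta : 'I_d -> C) :
  orth_projector_onto P (low_energy psi E x) ->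
  nsq ((1%:M - P) *m \sum_k beta k *: psi k) <=
  \sum_(k | ~~ (E k <= x)) Normc.normc (beta k) ^+ 2.
Proof.
move=> [Ps PP PV]; pose hi k := if E k <= x then 0 else beta k.
have -> : (1%:M - P) *m (\sum_k beta k *: psi k) =
    (1%:M - P) *m (\sum_k hi k *: psi k).
  rewrite !mulmx_sumr; apply: eq_bigr => k _; rewrite /hi; case: ifP => // Ek.
  rewrite scale0r mulmx0 -scalemxAr mulmxBl mul1mx (PV _).1 ?subrr ?scaler0 //.
  by apply/memv_span/map_f; rewrite mem_filter Ek mem_enum.
apply: (@le_trans _ _ (nsq (\sum_k hi k *: psi k))).
  by rewrite [leRHS](nsq_proj _ Ps PP) lerDr nsq_ge0.
rewrite nsq_expand [leRHS]big_mkcond; apply: ler_sum => k _; rewrite /hi.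
case: ifP => //= _.
by rewrite [leLHS](normc_real 0) expr0n.
Qed.

End Norms.

(** H psi_k is lam times a compression of the unitary [UH] applied to a unit vector. Hence (E_k -
    Lam) / (lam + |Lam|) lies in [-1, 1], where [S] is controlled. *)
Lemma eigenvalue_bound (R : realType) m n (H : 'M[R[i]]_(qdim n)) psi E
    (lam : R) (UH : 'M[R[i]]_(qdim (m + n))) k :
  orthonormal_eigenstates H psi E -> 0 < lam ->
  block_encodes (lam%:C)%C UH H -> `|E k| <= lam.
Proof.
move=> eig lam0 [UHu HE].
rewrite -(@ler_pXn2r _ 2) ?nnegrE // ?(ltW lam0) // real_normK ?num_real //.
have -> : E k ^+ 2 = nsq (H *m psi k).
  by rewrite eig.2 nsqZ normc_real (nsq_psi eig) mulr1.
rewrite HE -scalemxAl nsqZ normc_real -[leRHS]mulr1 ler_pM2l ?exprn_gt0 //.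
rewrite -(nsq_psi eig k) -!mulmxA.
apply: le_trans (nsq_coisometry _ (anc0_isometry _ _ _)) _.
rewrite nsq_isometry; last exact: unitary_adjmul.
by rewrite nsq_isometry ?anc0_isometry.
Qed.

Lemma aa_prep_ket0 (R : realType) m n (H : 'M[R[i]]_(qdim n)) psi E
    (lam Lam : R) (S : {poly R}) (US : 'M[R[i]]_(qdim (m.+2 + n)))
    UI alpha :
  orthonormal_eigenstates H psi E ->
  block_encodes 1 US (neg_sign_op S H lam Lam) ->
  UI *m ket0 R[i] n = \sum_k alpha k *: psi k ->
  (anc0 R[i] m.+3 n)^t* *m (aa_prep US UI *m ket0 R[i] (m.+3 + n)) =
  \sum_k (alpha k * (((1 - S.[(E k - Lam) / (lam + `|Lam|)]) / 2)%:C)%C) *: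
    psi k.
Proof.
move=> eig [_ bE] UIk.
have block : (anc0 R[i] m.+3 n)^t* *m Utheta US *m anc0 R[i] m.+3 n =
    2^-1 *: (1%:M + neg_sign_op S H lam Lam).
  rewrite bE scale1r (anc0_comp1 _ m.+2 n) adjmxM.
  have := congr1 (fun M => (anc0 R[i] m.+2 n)^t* *m M *m anc0 R[i] m.+2 n)
    (hadamard_test US).
  rewrite /= -scalemxAr -scalemxAl mulmxDr mulmxDl mulmx1 anc0_isometry => <-.
  by rewrite /Utheta !mulmxA.
rewrite -anc0_ket0 /aa_prep.
have -> : Utheta US *m onwires (@rshift m.+3 n) UI *m
      (anc0 R[i] m.+3 n *m ket0 R[i] n) =
    Utheta US *m (anc0 R[i] m.+3 n *m (\sum_k alpha k *: psi k)).
  rewrite -mulmxA; congr (_ *m _).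
  by rewrite mulmxA (onwires_anc0 m.+3 id) onwires_id -mulmxA UIk.
move: (Utheta US) block => T block.
rewrite !mulmxA block mulmx_sumr; apply: eq_bigr => k _.
rewrite -scalemxAr -scalerA; congr (_ *: _).
rewrite -scalemxAl mulmxDl mul1mx /neg_sign_op mulNmx.
rewrite (polymx_eigen S (shifted_eigen eig lam Lam k)) -[X in X - _]scale1r.
rewrite -scalerBl scalerA; congr (_ *: _).
by rewrite mulrC rmorphM rmorphB rmorph1 fmorphV rmorph_nat.
Qed.

Section ExactAmplification.
Variables (R : realType) (m n : nat).
Local Notation C := R[i].
Local Notation "x %:C" := (real_complex R x).

Definition rotation (c s : R) : 'M[C]_(qdim 1) :=
  mx1 (fun x y => (if x == y then c else if x then s else - s)%:C).

Lemma rotation_unitary c s : c ^+ 2 + s ^+ 2 = 1 -> rotation c s \is unitarymx.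
Proof.
move=> cs; apply: mx1_unitary => x y; rewrite !conj_real -!rmorphM -rmorphD.
rewrite -(rmorph_nat (real_complex R)); congr (_ %:C).
by case: x; case: y => /=; move: cs; rewrite !expr2 => cs; lra.
Qed.

(** [B] and [A] act on disjoint registers, so requiring the extra ancilla to be zero only
    contributes the upper left entry of [B]. *)
Lemma exact_prep_ket0 (B : 'M[C]_(qdim 1)) (A : 'M[C]_(qdim (m.+3 + n))) :
  (anc0 C m.+4 n)^t* *m (exact_prep B A *m ket0 C (m.+4 + n)) =
  B (rank [ffun=> false]) (rank [ffun=> false]) *:
    ((anc0 C m.+3 n)^t* *m (A *m ket0 C (m.+3 + n))).
Proof.
have k0 : ket0 C (m.+4 + n) = anc0 C 1 (m.+3 + n) *m ket0 C (m.+3 + n).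
  by rewrite anc0_ket0.
have AJ : (anc0 C 1 (m.+3 + n))^t* *m onwires (@rshift 1 (m.+3 + n)) A =
    A *m (anc0 C 1 (m.+3 + n))^t*.
  have e := onwires_anc0 1 id (A^t*); rewrite onwires_id in e.
  transitivity ((onwires (@rshift 1 (m.+3 + n) \o id) (A^t*) *m
    anc0 C 1 (m.+3 + n))^t*).
    by rewrite adjmxM onwires_adj adjmxK.
  by rewrite e adjmxM adjmxK.
have BJ : (anc0 C 1 (m.+3 + n))^t* *m (onwires (@lshift 1 (m.+3 + n)) B *m
    (anc0 C 1 (m.+3 + n) *m ket0 C (m.+3 + n))) =
    B (rank [ffun=> false]) (rank [ffun=> false]) *: ket0 C (m.+3 + n).
  apply: mx_bitsP => x j.
  by rewrite adj_anc0_mul pad1_qcons lshift_anc01 [RHS]mxE.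
rewrite k0 (anc0_comp1 _ m.+3 n) adjmxM /exact_prep -mulmxA.
rewrite -[onwires _ A *m _ *m _]mulmxA [X in _ *m X]mulmxA AJ -mulmxA BJ.
by rewrite -!scalemxAr.
Qed.

Lemma exprmx_iter d (Q : 'M[C]_d) r (v : 'cV[C]_d) :
  Q ^+ r *m v = iter r (mulmx Q) v.
Proof.
elim: r => [|r IH]; first by rewrite expr0 mul1mx.
by rewrite exprS -mulmxA IH.
Qed.

(** The good part of the prepared state is sin theta times phi. After r iterates its coefficient is
    sin((2r+1) theta) / sin theta = 1 / sin theta, while the bad part carries cos(pi / 2) = 0. *)
Lemma amplify_exact B US UI (r : nat) (theta : R) (phi : 'cV[C]_(qdim n)) :
  exact_prep B (aa_prep US UI) \is unitarymx ->
  nsq phi = 1 -> sin theta != 0 -> cos theta != 0 ->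
  theta *+ (2 * r + 1) = pi / 2 ->
  (anc0 C m.+4 n)^t* *m
    (exact_prep B (aa_prep US UI) *m ket0 C (m.+4 + n)) =
    (sin theta)%:C *: phi ->
  amplify B US UI r *m ket0 C (m.+4 + n) = anc0 C m.+4 n *m phi.
Proof.
move=> Au phi1 s0 c0 thr Jpsi.
pose s j := (sin (theta *+ (2 * j + 1)) / sin theta)%:C.
pose c j := (cos (theta *+ (2 * j + 1)) / cos theta)%:C.
pose v := (anc0 C m.+4 n)^t* *m
  (exact_prep B (aa_prep US UI) *m ket0 C (m.+4 + n)).
have good : v^t* *m v = (sin theta ^+ 2)%:C%:M.
  by rewrite /v Jpsi nsqE nsqZ phi1 mulr1 normc_real.
have c2 : 1 - sin theta ^+ 2 = cos theta ^+ 2.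
  by rewrite -(cos2Dsin2 theta); ring.
have step j : theta *+ (2 * j.+1 + 1) = theta *+ (2 * j + 1) + theta *+ 2.
  by rewrite -mulrnDr; congr (_ *+ _); lia.
have sin2 : sin (theta *+ 2) = 2 * sin theta * cos theta.
  by rewrite sin_mulr2n -mulr_natl; ring.
have cos2 : cos (theta *+ 2) = 1 - 2 * sin theta ^+ 2.
  by rewrite cos_mulr2n -mulr_natl -c2; ring.
rewrite /amplify -mulmxA exprmx_iter.
rewrite (aa_iterate_trig Au (ket0_norm _ _) (anc0_isometry _ _ _) good
  (c := c) (s := s)).
- rewrite /s /c thr sin_pihalf cos_pihalf mul0r scale0r addr0 Jpsi.
  by rewrite -scalemxAr scalerA -rmorphM div1r mulVf // scale1r.
- move=> j; rewrite /s /c step sinD cos2 sin2.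
  rewrite -!(rmorph_nat (real_complex R)) -!rmorphM -!rmorphB -!rmorphM.
  rewrite -rmorphD.
  by congr (_%:C); rewrite c2; field; rewrite s0 c0.
- move=> j; rewrite /s /c step cosD cos2 sin2.
  rewrite -!(rmorph_nat (real_complex R)) -!rmorphM -!rmorphB -!rmorphM.
  rewrite -rmorphB.
  by congr (_%:C); field; rewrite s0 c0.
- by rewrite /s muln0 add0n mulr1n divff.
by rewrite /c muln0 add0n mulr1n divff.
Qed.

End ExactAmplification.

Section SineBound.
Import numFieldNormedType.Exports.

Lemma sin_le_id (R : realType) (x : R) : 0 <= x -> sin x <= x.
Proof.
move=> x0.
have [|c _] := @MVT_segment R sin cos 0 x x0 (fun y _ => is_derive_sin y).
  exact/continuous_subspaceT/continuous_sin.
by rewrite sin0 !subr0 => ->; rewrite ler_piMl ?cos_le1.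
Qed.

End SineBound.

Lemma amplified_state (R : realType) (m n : nat) (H : 'M[R[i]]_(qdim n))
    psi E (lam Lam delta eps gamma c : R) (UH : 'M[R[i]]_(qdim (m + n)))
    (UI : 'M[R[i]]_(qdim n)) alpha P S (US : 'M[R[i]]_(qdim (m.+2 + n))) r :
  orthonormal_eigenstates H psi E ->
  0 < lam -> 0 < delta < 1 -> 0 < eps < 1 -> 0 < gamma < 1 ->
  block_encodes (lam%:C)%C UH H ->
  UI \is unitarymx ->
  UI *m ket0 R[i] n = \sum_k alpha k *: psi k ->
  gamma ^+ 2 < \sum_(k | E k <= Lam - delta * (lam + `|Lam|))
                 Normc.normc (alpha k) ^+ 2 ->
  orth_projector_onto P (low_energy psi E (Lam + delta * (lam + `|Lam|))) ->
  sign_poly c delta (eps * gamma) S ->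
  block_encodes 1 US (neg_sign_op S H lam Lam) ->
  2 / gamma < r%:R ->
  exists (B : 'M[R[i]]_(qdim 1)) (phi : 'cV[R[i]]_(qdim n)),
  [/\ B \is unitarymx, nsq phi = 1, nsq ((1%:M - P) *m phi) < eps ^+ 2 &
      amplify B US UI r *m ket0 R[i] (m.+4 + n) = anc0 R[i] m.+4 n *m phi].
Proof.
move=> eig lam0 /andP[d0 d1] /andP[e0 e1] /andP[g0 g1] bH UIu UIk low PP.
move=> [_ _ _ sgnS] bS rg.
pose x k := (E k - Lam) / (lam + `|Lam|).
pose t k := (1 - S.[x k]) / 2.
have den0 : 0 < lam + `|Lam| by rewrite ltr_pwDl.
have x1 k : `|x k| <= 1.
  rewrite normrM normfV (gtr0_norm den0) ler_pdivrMr // mul1r.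
  apply: le_trans (ler_normB _ _) _.
  by rewrite lerD2r (eigenvalue_bound _ eig lam0 bH).
have eg1 : eps * gamma < 1 by nra.
(* Here S + 1 <= eps * gamma, so t k is at least 1 - eps * gamma / 2; the weaker 1/2 keeps the
   constants free of eps. *)
have t_low k : E k <= Lam - delta * (lam + `|Lam|) -> 1 / 2 <= t k.
  move=> Ek; have xd : x k <= - delta.
    by rewrite ler_pdivrMr //; lra.
  have x0 : x k < 0 by lra.
  have := sgnS (x k); rewrite x1 andbT ltr0_norm // ltr0_sg // lerNr => /(_ xd).
  rewrite ler_norml => /andP[_]; rewrite /t; lra.
(* Energies strictly between the two thresholds get no bound: they are counted neither in the lower
   bound for p nor in the part outside the target space. *)
have t_high k : ~~ (E k <= Lam + delta * (lam + `|Lam|)) ->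
    t k ^+ 2 <= (eps * gamma / 2) ^+ 2.
  rewrite -ltNge => Ek; have xd : delta < x k.
    by rewrite ltr_pdivlMr //; lra.
  have x0 : 0 < x k by lra.
  have := sgnS (x k).
  rewrite x1 andbT gtr0_norm // gtr0_sg // (ltW xd) => /(_ isT).
  rewrite ler_norml => /andP[h1 h2].
  by rewrite -subr_ge0 subr_sqr mulr_ge0 // /t; lra.
pose beta k := alpha k * ((t k)%:C)%C.
have beta2 k :
    Normc.normc (beta k) ^+ 2 = Normc.normc (alpha k) ^+ 2 * t k ^+ 2.
  by rewrite Normc.normcM exprMn normc_real.
pose g := \sum_k beta k *: psi k.
have gE : (anc0 R[i] m.+3 n)^t* *m (aa_prep US UI *m ket0 R[i] (m.+3 + n)) = g.
  exact: aa_prep_ket0 eig bS UIk.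
have alpha1 : \sum_k Normc.normc (alpha k) ^+ 2 = 1.
  rewrite -(nsq_expand eig) -UIk nsq_isometry; last exact: unitary_adjmul.
  by apply: (@complexI R); have := ket0_norm R[i] n; rewrite nsqE;
     move=> /matrixP/(_ 0 0); rewrite !mxE eqxx !mulr1n.
have nsqg : (gamma / 2) ^+ 2 < nsq g.
  rewrite (nsq_expand eig); under eq_bigr => k _ do rewrite beta2.
  rewrite (bigID (fun k => E k <= Lam - delta * (lam + `|Lam|))) /=.
  rewrite ltr_wpDr //.
    by apply: sumr_ge0 => k _; rewrite mulr_ge0 ?sqr_ge0.
  apply: (@lt_le_trans _ _ (\sum_(k | E k <= Lam - delta * (lam + `|Lam|))
                 Normc.normc (alpha k) ^+ 2 * (1 / 2) ^+ 2)).
    rewrite -mulr_suml expr_div_n expr_div_n expr1n mul1r ltr_pM2r //.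
    by rewrite invr_gt0 exprn_gt0.
  apply: ler_sum => k Ek; rewrite ler_wpM2l ?sqr_ge0 //.
  by apply: lerXn2r; rewrite ?nnegrE ?t_low //; have := t_low k Ek; lra.
pose p := Num.sqrt (nsq g).
have p2 : p ^+ 2 = nsq g by rewrite sqr_sqrtr ?nsq_ge0.
have pg : gamma / 2 < p.
  rewrite -(@ltr_pXn2r _ 2) ?nnegrE ?sqrtr_ge0 ?p2 //; lra.
have p0 : 0 < p by lra.
pose theta : R := (pi / 2) / (2 * r + 1)%:R.
have r0 : (0 : R) < r%:R by apply: lt_trans rg; rewrite divr_gt0.
have N0 : 0 < (2 * r + 1)%:R :> R by rewrite ltr0n addn1.
have ph0 : 0 < pi / 2 :> R by have := @pi_gt0 R; lra.
have th0 : 0 < theta by exact: divr_gt0.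
have thr : theta *+ (2 * r + 1) = pi / 2.
  by rewrite -[LHS]mulr_natr /theta divfK // gt_eqF.
have rN : (2 * r + 1)%:R = 2 * r%:R + 1 :> R by rewrite natrD natrM.
have th_lt : theta < pi / 2.
  by rewrite ltr_pdivrMr // ltr_pMr // rN; lra.
(* As pi / 2 < 2, theta < 2 / (2 r + 1) < 1 / r < gamma / 2 < p. *)
have th_p : theta < p.
  apply: lt_trans pg; rewrite ltr_pdivrMr // rN.
  have := @pihalf_lt2 R; move: rg; rewrite ltr_pdivrMr //; nra.
have s0 : 0 < sin theta by by apply: sin_gt0_pi; apply/andP; split=> //; lra.
have c0 : 0 < cos theta.
  by apply: cos_gt0_pihalf; apply/andP; split=> //; lra.
have sp : sin theta <= p by apply: le_trans (sin_le_id (ltW th0)) (ltW th_p).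
pose b := sin theta / p.
have b1 : b ^+ 2 <= 1.
  have b0 : 0 <= b by rewrite divr_ge0 ?ltW.
  by rewrite expr_le1 // /b ler_pdivrMr // mul1r.
(* The entry b = sin theta / p rescales the good part g, of norm p, to sin theta times the unit
   vector g / p; amplification then delivers g / p itself. *)
exists (rotation b (Num.sqrt (1 - b ^+ 2))), (((p^-1)%:C)%C *: g).
have Bu : rotation b (Num.sqrt (1 - b ^+ 2)) \is unitarymx.
  by apply: rotation_unitary; rewrite sqr_sqrtr ?subr_ge0 // addrC subrK.
have phi1 : nsq (((p^-1)%:C)%C *: g) = 1.
  by rewrite nsqZ normc_real -p2 exprVn mulVf // expf_neq0 // gt_eqF.
split=> //.
- rewrite -scalemxAr nsqZ normc_real.
  have hb := orth_projector_contract eig beta PP.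
  apply: le_lt_trans (ler_wpM2l (sqr_ge0 _) hb) _.
  (* The weights |alpha_k|^2 above the gap sum to at most 1, and p > gamma / 2 makes the remaining
     factor smaller than eps^2. *)
  apply: (@le_lt_trans _ _ (p^-1 ^+ 2 * (eps * gamma / 2) ^+ 2)).
    rewrite ler_wpM2l ?sqr_ge0 //; under eq_bigr => k _ do rewrite beta2.
    apply: (@le_trans _ _ (\sum_(k | ~~ (E k <= Lam + delta * (lam + `|Lam|)))
        Normc.normc (alpha k) ^+ 2 * (eps * gamma / 2) ^+ 2)).
      by apply: ler_sum => k Ek; rewrite ler_wpM2l ?sqr_ge0 ?t_high.
    rewrite -mulr_suml -[leRHS]mul1r ler_wpM2r ?sqr_ge0 // -alpha1.
    rewrite [leRHS]
      (bigID (fun k => ~~ (E k <= Lam + delta * (lam + `|Lam|)))) /= lerDl.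
    by apply: sumr_ge0 => k _; apply: sqr_ge0.
  rewrite -exprMn mulrC ltr_pXn2r ?nnegrE ?divr_ge0 ?mulr_ge0 ?invr_ge0 ?ltW //.
  by rewrite ltr_pdivrMr //; nra.
apply: (amplify_exact (theta := theta)) => //.
- by apply: exact_prep_unitary => //; case: bS.
- exact: lt0r_neq0.
- exact: lt0r_neq0.
rewrite exact_prep_ket0 gE scalerA; congr (_ *: _).
by rewrite mxE !rankK !ffunE eqxx -rmorphM.
Qed.

(** * Resource counts *)

Lemma ln_inv_ge (R : realType) (x : R) : 0 < x -> 1 - x <= ln x^-1.
Proof.
move=> x0; have /le_ln1Dx : -1 < x - 1 by lra.
by rewrite addrC subrK lnV ?posrE //; lra.
Qed.

(** In [K], the first summand is 14 gates per controlled instruction, times 3 |cG| + 1 for the size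
    of the U_S circuit, times 14 |cS| from 2 r + 1 <= 7 / gamma and the degree bound. The second
    summand covers the queries to U_H. The 2000 absorbs 3 * 7 + 1689 from the reflections and fixed
    gates, and the 56 gates per system qubit. Absolute values are taken because cS and cG have no
    prescribed sign. *)
Lemma resource_bounds (R : realType) (cS cG : R) (m n r deg sz qH : nat)
    (delta eps gamma : R) :
  0 < delta < 1 -> 0 < eps < 1 -> 0 < gamma < 1 ->
  r%:R <= 3 / gamma ->
  deg%:R <= cS * (delta^-1 * (1 + ln ((eps * gamma)^-1))) ->
  (qH <= deg)%N -> sz%:R <= cG * ((m + 2) * deg)%:R + deg%:R ->
  let K := 14 * (14 * (3 * `|cG| + 1) * `|cS|) + 14 * `|cS| + 2000 in
  let Y := (gamma * (1 - eps * gamma))^-1 in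
  let X := (gamma * (1 - eps * gamma) * delta)^-1 * ln ((gamma * eps)^-1) in
  [/\ ((2 * r + 1) * qH)%:R <= K * X, (2 * r + 1)%:R <= K * Y,
      r%:R <= K * Y &
      (r * (2 * (14 * sz + 3) + 112 * (m + 4) + 56 * n + 3) + (14 * sz + 3))%:R
      <= K * ((maxn 1 m)%:R * (gamma * (1 - eps * gamma) * delta)^-1
              * ln ((gamma * eps)^-1)) + K * (r * n)%:R].
Proof.
move=> /andP[d0 d1] /andP[e0 e1] /andP[g0 g1] rg dg qd szd K Y X.
set M := maxn 1 m; rewrite -[_ * _ * ln _]mulrA -/X.
have ge0 : 0 < eps * gamma by rewrite mulr_gt0.
have ge1 : eps * gamma < 1 by nra.
set L := ln ((gamma * eps)^-1) in X *.
have LE : 1 - eps * gamma <= L by rewrite /L [gamma * _]mulrC; exact: ln_inv_ge.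
rewrite [eps * gamma]mulrC -/L in dg.
set u := 1 - eps * gamma in Y X LE *.
have u0 : 0 < u by rewrite /u subr_gt0.
have u1 : u <= 1 by rewrite /u; lra.
have L0 : 0 < L by lra.
(* Both 1 and L are at most T, because u <= L and u <= 1. So the 1 + L of the degree bound becomes 2
   T, and [X] is T / (gamma * delta). *)
pose T := L / u.
have T1 : 1 <= T by rewrite ler_pdivlMr // mul1r.
have LT : L <= T by rewrite ler_pdivlMr // ler_piMr // ltW.
have XE : X = gamma^-1 * delta^-1 * T by rewrite /X /T !invfM; ring.
clearbody T.
have gi : 1 <= gamma^-1 by rewrite invf_ge1 // ltW.
have di : 1 <= delta^-1 by rewrite invf_ge1 // ltW.
have ui : 1 <= u^-1 by rewrite invf_ge1.
have gi0 : 0 <= gamma^-1 by rewrite invr_ge0 ltW.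
have gX : gamma^-1 <= X.
  by rewrite XE -mulrA ler_peMr ?mulr_ege1.
have gY : gamma^-1 <= Y by rewrite /Y invfM ler_peMr.
have gp0 : 0 < gamma^-1 by rewrite invr_gt0.
have X0 : 0 < X by exact: lt_le_trans gX.
clearbody X Y L u.
have M1 : (1 : R) <= M%:R by rewrite ler1n leq_maxl.
have mM : m%:R <= M%:R :> R by rewrite ler_nat leq_maxr.
clearbody M.
have degE : deg%:R <= 2 * `|cS| * (delta^-1 * T).
  apply: le_trans dg _; apply: (@le_trans _ _ (`|cS| * (delta^-1 * (1 + L)))).
    by rewrite ler_wpM2r ?ler_norm // mulr_ge0 ?addr_ge0 ?invr_ge0 // ltW.
  rewrite [2 * _]mulrC -mulrA ler_wpM2l // mulrCA.
  rewrite ler_wpM2l ?invr_ge0 ?(ltW d0) //.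
  by rewrite mulr_natl mulr2n lerD.
have r2 : (2 * r + 1)%:R <= 7 * gamma^-1 :> R.
  by rewrite natrD natrM; move: rg gi; clear; lra.
have degX : (2 * r + 1)%:R * deg%:R <= 14 * `|cS| * X.
  apply: (@le_trans _ _ (7 * gamma^-1 * (2 * `|cS| * (delta^-1 * T)))).
    by apply: ler_pM.
  by rewrite XE le_eqVlt; apply/orP; left; apply/eqP; ring.
have cS0 := normr_ge0 cS; have cG0 := normr_ge0 cG.
have Kge1 : 14 * `|cS| + 2000 <= K.
  by rewrite /K -addrA lerDr !mulr_ge0 ?addr_ge0 ?mulr_ge0.
have Kge2 : 2000 <= K by move: Kge1 cS0; clear; lra.
split.
- rewrite natrM; apply: (@le_trans _ _ ((2 * r + 1)%:R * deg%:R)).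
    by rewrite ler_wpM2l // ler_nat.
  apply: le_trans degX _; rewrite ler_wpM2r ?(ltW X0) //.
  by move: Kge1; clear; lra.
- apply: le_trans r2 _; apply: ler_pM => //.
  by move: Kge2; clear; lra.
- apply: le_trans rg _; apply: ler_pM => //.
  by move: Kge2; clear; lra.
(* m + 2 <= 3 M since M >= 1; the additional 1 accounts for the queries, which count as instructions
   of the circuit. *)
have szE : sz%:R <= (3 * `|cG| + 1) * M%:R * deg%:R.
  apply: le_trans szd _.
  apply: (@le_trans _ _ (`|cG| * ((m + 2) * deg)%:R + deg%:R)).
    by rewrite lerD2r ler_wpM2r // ler_norm.
  rewrite natrM natrD; have dg0 : (0 : R) <= deg%:R by [].
  have : `|cG| * ((m%:R + 2) * deg%:R) <= `|cG| * ((3 * M%:R) * deg%:R).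
    rewrite ler_wpM2l // ler_wpM2r //.
    by move: mM M1; clear; lra.
  have : deg%:R <= M%:R * deg%:R :> R by rewrite ler_peMl.
  by clear; lra.
have r20 : (0 : R) <= (2 * r + 1)%:R by [].
have t1 : (2 * r + 1)%:R * sz%:R <= (3 * `|cG| + 1) * (14 * `|cS|) * (M%:R * X).
  apply: (@le_trans _ _ ((2 * r + 1)%:R * ((3 * `|cG| + 1) * M%:R * deg%:R))).
    by rewrite ler_wpM2l.
  have -> : (2 * r + 1)%:R * ((3 * `|cG| + 1) * M%:R * deg%:R) =
    ((3 * `|cG| + 1) * M%:R) * ((2 * r + 1)%:R * deg%:R) by ring.
  have -> : (3 * `|cG| + 1) * (14 * `|cS|) * (M%:R * X) =
    ((3 * `|cG| + 1) * M%:R) * (14 * `|cS| * X) by ring.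
  by rewrite ler_wpM2l // mulr_ge0 ?addr_ge0 ?mulr_ge0.
have t2 : (2 * r + 1)%:R <= 7 * (M%:R * X).
  apply: le_trans r2 _; rewrite ler_wpM2l //.
  by apply: le_trans gX _; rewrite ler_peMl // ltW.
(* 563 = 112 + 448 + 3, using M >= 1, and r <= 3 / gamma <= 3 X; their product gives 1689. *)
have t3 : r%:R * (112 * (m%:R + 4) + 3) <= 1689 * (M%:R * X).
  apply: (@le_trans _ _ (3 * X * (563 * M%:R))).
    apply: ler_pM => //; first by rewrite addr_ge0 ?mulr_ge0 ?addr_ge0.
      by apply: le_trans rg _; rewrite ler_wpM2l.
    by move: mM M1; clear; lra.
  by rewrite le_eqVlt; apply/orP; left; apply/eqP; ring.
have -> : (r * (2 * (14 * sz + 3) + 112 * (m + 4) + 56 * n + 3) +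
      (14 * sz + 3))%:R =
     14 * ((2 * r + 1)%:R * sz%:R) + 3 * (2 * r + 1)%:R +
     r%:R * (112 * (m%:R + 4) + 3) + 56 * (r * n)%:R :> R.
  by rewrite !(natrD, natrM); ring.
have rn : 56 * (r * n)%:R <= K * (r * n)%:R.
  by rewrite ler_wpM2r //; move: Kge2; clear; lra.
have MX : 0 < M%:R * X by rewrite mulr_gt0 // (lt_le_trans ltr01).
have : K * (M%:R * X) = 14 * ((3 * `|cG| + 1) * (14 * `|cS|) * (M%:R * X)) +
  14 * `|cS| * (M%:R * X) + 2000 * (M%:R * X) by rewrite /K; ring.
have : 0 <= 14 * `|cS| * (M%:R * X) by rewrite !mulr_ge0 // ltW.
by move: t1 t2 t3 rn MX; clear; lra.
Qed.

(** [K] is fixed before all the data and depends only on the constants of the sign polynomial and of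
    its quantum signal processing circuit. The separate term in r * n of the gate count comes from
    the reflection about the all-zero state, which in each of the r iterates runs over the n system
    qubits. Using [maxn 1 m] covers m = 0, where the fixed ancillas remain. *)
Theorem theorem8 (R : realType) (cS cG : R) :
  exists K : R, 0 < K /\
  forall (m n : nat) (H : 'M[R[i]]_(qdim n))
    (psi : 'I_(qdim n) -> 'cV[R[i]]_(qdim n)) (E : 'I_(qdim n) -> R)
    (lam Lam delta eps gamma : R)
    (UH : 'M[R[i]]_(qdim (m + n))) (UI : 'M[R[i]]_(qdim n))
    (alpha : 'I_(qdim n) -> R[i]) (P : 'M[R[i]]_(qdim n))
    (S : {poly R}) (US : 'M[R[i]]_(qdim (m.+2 + n)))
    (circS : circuit R[i] m n (m.+2 + n)),
  H^t* = H ->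
  orthonormal_eigenstates H psi E ->
  0 < lam -> 0 < delta < 1 -> 0 < eps < 1 -> 0 < gamma < 1 ->
  block_encodes (lam%:C)%C UH H ->
  UI \is unitarymx ->
  UI *m ket0 R[i] n = \sum_k alpha k *: psi k ->
  gamma ^+ 2 < \sum_(k | E k <= Lam - delta * (lam + `|Lam|))
                 Normc.normc (alpha k) ^+ 2 ->
  orth_projector_onto P (low_energy psi E (Lam + delta * (lam + `|Lam|))) ->
  sign_poly cS delta (eps * gamma) S ->
  qsp_circuit cG UH UI H lam Lam S US circS ->
  exists (r w : nat) (B : 'M[R[i]]_(qdim 1))
    (c : circuit R[i] m n (w + (m.+4 + n)))
    (psi' : 'cV[R[i]]_(qdim (m.+3 + n))),
    (B \is unitarymx /\ implements UH UI c (amplify B US UI r)) /\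
    (circuit_mx UH UI c *m ket0 R[i] (w + (m.+4 + n)) =
       anc0 R[i] w (m.+4 + n) *m (anc0 R[i] 1 (m.+3 + n) *m psi') /\
     fidelity_state eps P psi') /\
    ((queries HamOracle c)%:R <=
       K * ((gamma * (1 - eps * gamma) * delta)^-1 * ln ((gamma * eps)^-1)) /\
     (queries PrepOracle c)%:R <= K * (gamma * (1 - eps * gamma))^-1) /\
    ((w + (m.+4 + n))%:R <= K * (maxn 1 m + n)%:R /\
     (w + m.+4)%:R <= K * (maxn 1 m)%:R) /\
    (r%:R <= K * (gamma * (1 - eps * gamma))^-1 /\
     (gates c)%:R <=
       K * ((maxn 1 m)%:R * (gamma * (1 - eps * gamma) * delta)^-1
              * ln ((gamma * eps)^-1))
       + K * (r * n)%:R).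
Proof.
exists (14 * (14 * (3 * `|cG| + 1) * `|cS|) + 14 * `|cS| + 2000); split.
  by rewrite ltr_wpDl ?addr_ge0 ?mulr_ge0 ?addr_ge0 ?mulr_ge0.
move=> m n H psi E lam Lam delta eps gamma UH UI alpha P S US circS _ eig lam0.
move=> hd he hg bH UIu UIk low PP sgnS [bS cSE hHam hPrep hG].
have UHu : UH \is unitarymx by case: bH.
have USu : US \is unitarymx by case: bS.
have g0 : 0 < gamma by case/andP: hg.
have gi1 : 1 <= gamma^-1 by rewrite invf_ge1 // ltW //; case/andP: hg.
(* The least integer above 2 / gamma; as 1 <= 1 / gamma, it is at most 3 / gamma. *)
pose r := (Num.truncn (2 / gamma)).+1.
have rgt : 2 / gamma < r%:R by apply: truncnS_gt.
have rle : r%:R <= 3 / gamma.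
  rewrite -[r]addn1 natrD -lerBrDr.
  have tle : (Num.truncn (2 / gamma))%:R <= 2 / gamma.
    by rewrite truncn_le divr_ge0 // ltW.
  by apply: le_trans tle _; move: gi1; clear; lra.
have [B [phi [Bu phi1 phiP amp]]] :=
  amplified_state eig lam0 hd he hg bH UIu UIk low PP sgnS bS rgt.
have [W [c [cW gc hc pc]] WV] := realizes_amplify UHu UIu USu Bu cSE r.
have [_ degS _ _] := sgnS.
have sz : (size circS)%:R <= cG * ((m + 2) * degree S)%:R + (degree S)%:R.
  rewrite (size_circuit circS) hPrep addn0 natrD lerD // ler_nat.
  exact: hHam.
have [b1 b2 b3 b4] := resource_bounds n hd he hg rle degS hHam sz.
(* The 2 is the number of work qubits of [realizes]. The state psi' has its m + 3 ancillas in zero,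
   and the ancilla of [B] is returned to zero as well. *)
exists r, 2%N, B, c, (anc0 R[i] m.+3 n *m phi).
split; first by split=> //; rewrite /implements cW.
split.
  split.
    have -> : circuit_mx UH UI c *m ket0 R[i] (2 + (m.+4 + n)) =
        anc0 R[i] 2 (m.+4 + n) *m (anc0 R[i] m.+4 n *m phi).
      by rewrite -anc0_ket0 cW [LHS]mulmxA WV -mulmxA amp.
    by rewrite (anc0_comp1 _ m.+3 n) -[X in _ *m X = _]mulmxA.
  rewrite /fidelity_state mulmxA anc0_isometry mul1mx.
  split; rewrite /l2norm -/(nsq _); first by rewrite phi1 sqrtr1.
  have e0 : 0 < eps by case/andP: he.
  rewrite -[ltRHS]gtr0_norm // -sqrtr_sqr ltr_sqrt // exprn_gt0 //.
split.
  split; first by apply: le_trans b1; rewrite ler_nat.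
  by apply: le_trans b2; rewrite ler_nat (leq_trans pc) // hPrep muln1.
split.
  (* There are 2 + (m + 4) auxiliary qubits, and m + 6 <= 7 max(1, m), with equality at m = 1. *)
  have K7 : 7 <= 14 * (14 * (3 * `|cG| + 1) * `|cS|) + 14 * `|cS| + 2000.
    rewrite -[leLHS]add0r lerD ?ler_nat //.
    by rewrite addr_ge0 ?mulr_ge0 ?addr_ge0 ?mulr_ge0.
  set K := _ + 2000 in K7 *.
  have K7le (a b : nat) : (a <= 7 * b)%N -> a%:R <= K * b%:R.
    move=> ab; apply: (@le_trans _ _ (7 * b%:R)); last first.
      apply: ler_wpM2r; [exact: ler0n | exact: K7].
    by rewrite -natrM ler_nat.
  have m1 := leq_maxl 1 m; have mm := leq_maxr 1 m.
  by split; apply: K7le; move: m1 mm; clear; lia.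
split=> //; apply: le_trans b4; by rewrite ler_nat.
Qed.
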